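(* Let $k\in\mathbb{N}\cup\{0\}$, $\varepsilon_0,\dots,\varepsilon_k\in\mathbb{R}_+$, and set \[ \varepsilon=\min\Big\{\tfrac{(k+2)\varepsilon_i}{k+1-i}\ \Big|\ i\in\{0,\dots,k\}\Big\},\qquad \lambda=\tfrac1d\min\Big\{\big(\tfrac{\varepsilon}{(k+1)^2 2^{2k+6}}\big)^{2^k},1\Big\}. \] Let $(X,\mathcal{F})$ be a sheaved strongly connected $d$-complex with $d\ge k+1$ such that: (1) $(X,\mathcal{F})$ is an $i$-local $\varepsilon_i$-coboundary expander in dimension $k$ for all $i\in\{0,\dots,k\}$; (2) $X$ is a $(d-2)$-local $[-1,\lambda]$-spectral expander; (3) $\mathcal{F}(x)\ne0$ for all $x\in X(k+1)$. Then $(X,\mathcal{F})$ $\frac{\varepsilon}{2}$-expands $\big(\frac{\varepsilon}{(k+1)^22^{2k+6}}\big)^{2^{k+1}-1}$-small locally minimal $k$-cochains.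
   Context: A $d$-complex is a finite simplicial complex (faces are finite vertex sets closed under subsets, including $\emptyset$) in which every face lies in a $d$-face; $X(i)$ denotes the $i$-faces. Link $X_z=\{x\setminus z:z\subseteq x\in X\}$; $X$ is strongly connected if all links $X_z$ ($z\in X$, including $z=\emptyset$) are connected. Canonical weight of $x\in X(k)$: $w(x)=\binom{d+1}{k+1}^{-1}|X(d)|^{-1}|\{y\in X(d):y\supseteq x\}|$. A sheaf $\mathcal{F}$ on $X$: abelian groups $\mathcal{F}(x)$ for nonempty $x$ and homomorphisms $\mathrm{res}_{y\leftarrow x}$ for nonempty $x\subsetneq y$ compatible under composition; augmented sheaves also include $\emptyset$ (sheaves have $\mathcal{F}(\emptyset)=0$). $C^k(X,\mathcal{F})$: alternating families over ordered $k$-faces; $(d_kf)(v_0..v_{k+1})=\sum_i(-1)^i\mathrm{res}f(v_0..\widehat{v_i}..v_{k+1})$; $B^k=\mathrm{im}\,d_{k-1}$. $\mathcal{F}_z$ on $X_z$: $\mathcal{F}_z(x)=\mathcal{F}(x\cup z)$ with induced restrictions. Norm $\|f\|=w(\{x:f(x)\neq0\})$ with respect to the canonical weights of the complex at hand; mass $m(k)=w(\{x\in X(k):\mathcal{F}(x)\ne0\})$. $\varepsilon$-coboundary expander in dimension $k$: $\|d_kf\|m(k)\ge\varepsilon\min_{b\in B^k}\|f+b\|m(k+1)$ for all $f\in C^k$. $i$-local $\varepsilon$-coboundary expander in dimension $k$: $(X_z,\mathcal{F}_z)$ is an $\varepsilon$-coboundary expander in dimension $k-i-1$ for all $z\in X(i)$.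 For an ordered face $z$ and $g\in C^j(X_z,\mathcal{F}_z)$, $g^z$ is the cochain on $X$ with $g^z(xz)=g(x)$ and $g^z(y)=0$ if $z\not\subseteq y$. $f\in C^k(X,\mathcal{F})$ is locally minimal if $\|f+d_{k-1}(g^z)\|\ge\|f\|$ for all $z\in X$ of dimension $i\in\{0,\dots,k-1\}$ and $g\in C^{k-i-2}(X_z,\mathcal{F}_z)$. ''$\beta$-expands $\alpha$-small locally minimal $k$-cochains'': $\|d_kf\|\ge\beta\|f\|$ for every locally minimal $f\in C^k$ with $\|f\|<\alpha$. Weighted adjacency operator $(\mathcal{A}f)(x)=\sum_{e\supseteq x}\frac{w(e)}{2w(x)}f(e\setminus x)$ on $\mathbb{R}^{X(0)}$; $[-1,\lambda]$-spectral expander: spectrum of $\mathcal{A}$ on mean-zero functions in $[-1,\lambda]$; $(d-2)$-local version: this holds for every link $X_z$, $z\in X(d-2)$, with its own canonical weights. *)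

(* Defs.v *)
From HB Require Import structures.
From mathcomp Require Export all_boot all_order all_fingroup all_algebra.
From mathcomp Require Export boolp reals.

Set Implicit Arguments.
Unset Strict Implicit.
Unset Printing Implicit Defensive.

Import Order.TTheory GRing.Theory Num.Theory.
Local Open Scope ring_scope.

(* Conventions.
   - A complex is its set of faces X : {set {set V}} over a finite type V; a
     member of V is a vertex of X only if its singleton is in X.
   - Faces, cochains, norms and masses are graded by the NUMBER OF VERTICES n,
     so grade n is dimension n - 1; grade 0 is the empty face, of dimension -1.
   - d is always the dimension of the complex at hand; the link of a face z in
     a d-complex has dimension d - #|z|. *)

Section Complexes.
Variable V : finType.
Implicit Types (X : {set {set V}}) (x y z : {set V}).

Definition is_dcomplex (d : nat) X : Prop :=
  [/\ set0 \in X,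
      (forall x y, y \in X -> x \subset y -> x \in X) &
      (forall x, x \in X -> exists2 y, y \in X & (#|y| == d.+1) && (x \subset y))].

Definition faces X (n : nat) : {set {set V}} := [set x in X | #|x| == n].

Definition link X z : {set {set V}} :=
  [set y :\: z | y in [set y in X | z \subset y]].

Definition adj X : rel V := [rel u v | [set u; v] \in X].

Definition connected_complex X : Prop :=
  forall u v, [set u] \in X -> [set v] \in X -> connect (adj X) u v.

(* Connectedness is only asked of the links of dimension >= 1, as usual for
   strong connectedness: the link of a (d-1)-face is a discrete set of points
   and the link of a d-face has no vertex. *)
Definition strongly_connected (d : nat) X : Prop :=
  forall z, z \in X -> (#|z| < d)%N -> connected_complex (link X z).

Definition ordered_face X (n : nat) x (v : seq V) : bool :=
  [&& x \in X, size v == n, uniq v & [set u in v] == x].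

End Complexes.

Section Weights.
Variables (R : realType) (V : finType).
Implicit Types (X : {set {set V}}) (x : {set V}).

Definition weight (d : nat) X x : R :=
  'C(d.+1, #|x|)%:R^-1 * #|faces X d.+1|%:R^-1
    * #|[set y in faces X d.+1 | x \subset y]|%:R.

(* Elements of R^X(0) are functions on {set V} of which only the values at the
   singleton faces matter. *)
Definition adjacency (d : nat) X (f : {set V} -> R) x : R :=
  \sum_(e in faces X 2 | x \subset e)
     weight d X e / (2 * weight d X x) * f (e :\: x).

Definition mean_zero (d : nat) X (f : {set V} -> R) : Prop :=
  \sum_(x in faces X 1) weight d X x * f x = 0.

(* The adjacency operator is self-adjoint for the weighted inner product, so
   its spectrum on the mean-zero functions is its set of real eigenvalues. *)
Definition spectral_expander (d : nat) X (lo hi : R) : Prop :=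
  forall (mu : R) (f : {set V} -> R),
    mean_zero d X f ->
    (exists2 x, x \in faces X 1 & f x != 0) ->
    (forall x, x \in faces X 1 -> adjacency d X f x = mu * f x) ->
    lo <= mu <= hi.

(* z ranges over the faces of dimension i - 1. *)
Definition local_spectral_expander (d : nat) X (i : nat) (lo hi : R) : Prop :=
  forall z, z \in faces X i -> spectral_expander (d - #|z|) (link X z) lo hi.

End Weights.

(* Values of sec outside X, and of res outside pairs of faces x \proper y, are
   irrelevant: nothing below depends on them. *)
Record aug_sheaf (V : finType) (X : {set {set V}}) := AugSheaf {
  sec :> {set V} -> zmodType;
  res : forall x y : {set V}, {additive sec x -> sec y};
  res_comp : forall x y z : {set V},
    x \in X -> y \in X -> z \in X -> x \proper y -> y \proper z ->
    forall a : sec x, res y z (res x y a) = res x z a }.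

Section Sheaves.
Variables (V : finType) (X : {set {set V}}).
Implicit Types (F : aug_sheaf X) (x y z : {set V}) (n d : nat).

Definition nontrivial (A : zmodType) : Prop := exists a : A, a != 0.

Definition is_sheaf F : Prop := forall a : F set0, a = 0.

Lemma link_setU z x : x \in link X z -> x :|: z \in X.
Proof.
case/imsetP=> y; rewrite inE => /andP[yX zy] ->.
by rewrite setDE setUIl [~: z :|: z]setUC setUCr setIT (setUidPl zy).
Qed.

Lemma link_proper z x y : x \in link X z -> y \in link X z ->
  x \proper y -> x :|: z \proper y :|: z.
Proof.
case/imsetP=> x' _ ->; case/imsetP=> y' _ ->.
rewrite !properE => /andP[sxy nyx]; rewrite setSU //=.
apply: contra nyx => /subsetP s; apply/subsetP=> u uy.
have := s u; rewrite !inE in uy *.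
by case/andP: uy => /negbTE -> ->; rewrite !orbF => ->.
Qed.

Lemma link_res_comp F z (x y t : {set V}) :
  x \in link X z -> y \in link X z -> t \in link X z ->
  x \proper y -> y \proper t ->
  forall a : F (x :|: z),
    res F (y :|: z) (t :|: z) (res F (x :|: z) (y :|: z) a)
      = res F (x :|: z) (t :|: z) a.
Proof.
move=> xX yX tX xy yt a.
by apply: res_comp; rewrite ?link_setU ?(link_proper (z := z)).
Qed.

Definition link_sheaf F z : aug_sheaf (link X z) :=
  @AugSheaf V (link X z) (fun x => F (x :|: z))
    (fun x y => res F (x :|: z) (y :|: z)) (@link_res_comp F z).

(* An ordered face is given redundantly as a pair (x, v) where the sequence v
   enumerates x; f x v is the value of f at v, an element of F x. Only the values
   at ordered faces of X matter. This spares transporting values of f along the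
   equality of the vertex sets of two orderings of the same face. *)
Definition cochain F := forall x : {set V}, seq V -> F x.

Definition is_cochain F n (f : cochain F) : Prop :=
  forall (x : {set V}) (v : n.-tuple V) (s : 'S_n), ordered_face X n x v ->
    f x [tuple tnth v (s i) | i < n] = f x v *~ (-1) ^+ s.

Definition addc F (f g : cochain F) : cochain F := fun x v => f x v + g x v.

Definition del (v : seq V) (i : nat) : seq V := take i v ++ drop i.+1 v.

Definition cobd F (f : cochain F) : cochain F := fun y v =>
  \sum_(i < size v)
     res F (y :\ tnth (in_tuple v) i) y (f (y :\ tnth (in_tuple v) i) (del v i))
       *~ (-1) ^+ i.

(* There is no cochain below dimension -1, so B^(-1) = 0. *)
Definition is_coboundary F n (b : cochain F) : Prop :=
  if n is n'.+1 then
    exists2 g : cochain F, is_cochain n' g &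
      forall x v, ordered_face X n x v -> b x v = cobd g x v
  else forall x v, ordered_face X 0 x v -> b x v = 0.

Variable R : realType.

(* Whether f vanishes at x does not depend on the ordering of x. *)
Definition norm F d n (f : cochain F) : R :=
  \sum_(x in faces X n | f x (enum x) != 0) weight R d X x.

Definition mass F d n : R :=
  \sum_(x in faces X n | `[< nontrivial (F x) >]) weight R d X x.

(* b attains the minimum of ||f + b|| over the coboundaries. *)
Definition cobd_expander F d n (eps : R) : Prop :=
  forall f : cochain F, is_cochain n f ->
    exists b : cochain F,
      [/\ is_coboundary n b,
          (forall b' : cochain F, is_coboundary n b' ->
             norm d n (addc f b) <= norm d n (addc f b')) &
          eps * norm d n (addc f b) * mass F d n.+1
            <= norm d n.+1 (cobd f) * mass F d n].

End Sheaves.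

Section LocalExpansion.
Variables (R : realType) (V : finType) (X : {set {set V}}).
Implicit Types (F : aug_sheaf X) (z : {set V}) (n d : nat).

(* h is g^z, where v is the ordered face z and h has grade n. *)
Definition is_extension F n z (v : seq V)
    (g : cochain (link_sheaf F z)) (h : cochain F) : Prop :=
  [/\ is_cochain n h,
      (forall x t, ordered_face (link X z) (n - size v) x t ->
         h (x :|: z) (t ++ v) = g x t) &
      (forall y t, ordered_face X n y t -> ~~ (z \subset y) -> h y t = 0)].

Definition locally_minimal F d n (f : cochain F) : Prop :=
  forall m z v, (0 < m < n)%N -> ordered_face X m z v ->
  forall g : cochain (link_sheaf F z), is_cochain (n.-1 - m) g ->
  forall h : cochain F, is_extension n.-1 v g h ->
    norm R d n f <= norm R d n (addc f (cobd h)).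

Definition expands_small_locally_minimal F d n (beta alpha : R) : Prop :=
  forall f : cochain F, is_cochain n f -> locally_minimal d n f ->
    norm R d n f < alpha -> beta * norm R d n f <= norm R d n.+1 (cobd f).

(* z ranges over the faces of dimension i - 1, and (X_z, F_z) is required to
   expand in grade n - i, i.e. in dimension (n - 1) - (i - 1) - 1. *)
Definition local_cobd_expander F d (i n : nat) (eps : R) : Prop :=
  forall z, z \in faces X i ->
    cobd_expander (link_sheaf F z) (d - #|z|) (n - i) eps.

End LocalExpansion.

(* Main.v *)
(* Let [A] be the support of a locally minimal cochain [f], and call a face [z]
   fat when, recursively downwards from [A], the fat faces covering [z] make up
   at least a fraction [eta ^ (2 ^ (k - #|z|))] of the faces covering [z]. As
   [f] is small, the empty face is not fat, so descending from [x \in A] through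
   fat faces ends at a nonempty terminal fat face [z]. The piece of [f] that
   descends to [z] is still minimal in the link of [z], so local coboundary
   expansion makes its coboundary large. If fat faces of a face [y] always meet
   in fat faces when they meet in codimension one, then all members of [A]
   inside [y] descend to the same [z], and at [y] the coboundary of [f] agrees
   with that of its piece at [z]. Any other [y] contains an edge between fat
   neighbours of a non-fat face; by trickling-down all links are spectral
   expanders, so such [y] are rare. Summing over [z] gives the bound. *)

From mathcomp Require Import sesquilinear spectral complex.
From mathcomp Require Import ring lra zify.
Require Import Defs.

Set Implicit Arguments.
Unset Strict Implicit.
Unset Printing Implicit Defensive.

Import Order.TTheory GRing.Theory Num.Theory.
Local Open Scope ring_scope.

Section QuadraticForms.
Variable R : rcfType.
Local Notation toC := (real_complex R).

Lemma map_real_complex_herm n (A : 'M[R]_n) :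
  A^T = A -> map_mx toC A \is hermsymmx.
Proof.
move=> symA; apply: realsym_hermsym.
  by apply/is_hermitianmxP; rewrite expr0 scale1r map_mx_id // map_trmx symA.
by apply/mxOverP => i j; rewrite mxE; apply/complex_realP; exists (A i j).
Qed.

Lemma spectral_diag_eigenvalue n (A : 'M[R]_n) i : A^T = A ->
  eigenvalue A (complex.Re (spectral_diag (map_mx toC A) 0 i)).
Proof.
move=> symA; set AC := map_mx toC A.
have hermA : AC \is hermsymmx by exact: map_real_complex_herm.
have /orthomx_spectralP := hermitian_normalmx hermA.
set P := spectralmx AC; set D := spectral_diag AC => AE.
have unitP : P \in unitmx by exact: spectral_unit.
have realD : D 0 i \is Num.real.
  by have /mxOverP := hermitian_spectral_diag_real hermA; apply.
rewrite eigenvalue_root_char -(fmorph_root toC) map_char_poly.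
rewrite /= RRe_real // -eigenvalue_root_char.
apply/eigenvalueP; exists (row i P).
  rewrite -[map_mx _ _]/AC -row_mul {1}AE !mulmxA mulmxV // mul1mx.
  apply/rowP => j.
  rewrite !mxE (bigD1 i) //= !mxE eqxx mulr1n big1 ?addr0 // => k /negPf ki.
  by rewrite !mxE eq_sym ki mulr0n mul0r.
apply/eqP => rowi0; have : (delta_mx 0 i : 'rV_n) *m P = 0 by rewrite -rowE.
move/(canRL (mulmxK unitP))/rowP/(_ i).
by rewrite mul0mx !mxE !eqxx => /eqP; rewrite oner_eq0.
Qed.

Lemma symmetric_form_le n (A : 'M[R]_n) (hi : R) : A^T = A ->
  (forall mu, eigenvalue A mu -> mu <= hi) ->
  forall x : 'rV[R]_n, (x *m A *m x^T) 0 0 <= hi * (x *m x^T) 0 0.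
Proof.
move=> symA eig x; set AC := map_mx toC A; set xC := map_mx toC x.
have hermA : AC \is hermsymmx by exact: map_real_complex_herm.
set P := spectralmx AC; set D := spectral_diag AC.
have AE : AC = invmx P *m diag_mx D *m P.
  by apply/orthomx_spectralP; exact: hermitian_normalmx.
have unitP : P \in unitmx by exact: spectral_unit.
pose y := xC *m invmx P.
have conj_y : P *m xC^T = (y ^t*)%sesqui.
  rewrite /y invmx_unitary ?spectral_unitarymx // trmx_mul map_mxM trmxCK.
  congr (_ *m _); apply/matrixP => i j; rewrite !mxE.
  by apply/esym/CrealP/complex_realP; exists (x j i).
have normE : toC ((x *m x^T) 0 0) = \sum_i `|y 0 i| ^+ 2.
  have -> : toC ((x *m x^T) 0 0) = (xC *m invmx P *m (P *m xC^T)) 0 0.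
    by rewrite mulmxA mulmxKV // map_trmx -map_mxM [RHS]mxE.
  by rewrite conj_y mxE; apply: eq_bigr => i _; rewrite !mxE normCK.
have formE : toC ((x *m A *m x^T) 0 0) = \sum_i D 0 i * `|y 0 i| ^+ 2.
  have -> : toC ((x *m A *m x^T) 0 0) = (y *m diag_mx D *m (P *m xC^T)) 0 0.
    by rewrite /y mulmxA -!(mulmxA xC) -AE map_trmx -!map_mxM mulmxA [RHS]mxE.
  rewrite conj_y mxE; apply: eq_bigr => i _.
  by rewrite mul_mx_diag !mxE normCK mulrAC mulrC.
rewrite -lecR rmorphM /= formE normE mulr_sumr; apply: ler_sum => i _.
rewrite ler_wpM2r ?exprn_ge0 ?normr_ge0 //.
rewrite -[D 0 i]RRe_real ?lecR; first exact/eig/spectral_diag_eigenvalue.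
by have /mxOverP := hermitian_spectral_diag_real hermA; apply.
Qed.

End QuadraticForms.

Section WeightedForms.
Variables (R : rcfType) (V : finType) (hi : R).
Implicit Types (f x : V -> R).

Lemma fin_symmetric_form_le (B : V -> V -> R) :
  (forall v v', B v v' = B v' v) ->
  (forall mu x, (exists v, x v != 0) ->
     (forall v, \sum_v' B v v' * x v' = mu * x v) -> mu <= hi) ->
  forall x, \sum_v \sum_v' B v v' * x v * x v' <= hi * \sum_v x v ^+ 2.
Proof.
move=> symB eig x.
pose A : 'M[R]_#|V| := \matrix_(i, j) B (enum_val i) (enum_val j).
pose row_of f : 'rV[R]_#|V| := \row_i f (enum_val i).
have rowA f v : (row_of f *m A) 0 (enum_rank v) = \sum_v' B v v' * f v'.
  rewrite mxE (reindex enum_rank) /=; last exact/onW_bij/enum_rank_bij.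
  by apply: eq_bigr => v' _; rewrite !mxE !enum_rankK symB mulrC.
have dotE f g : (row_of f *m (row_of g)^T) 0 0 = \sum_v f v * g v.
  rewrite mxE (reindex enum_rank) /=; last exact/onW_bij/enum_rank_bij.
  by apply: eq_bigr => v _; rewrite !mxE enum_rankK.
have row_ofK (y : 'rV_#|V|) : row_of (fun v => y 0 (enum_rank v)) = y.
  by apply/rowP => i; rewrite mxE enum_valK.
have AE f : row_of f *m A = row_of (fun v => \sum_v' B v v' * f v').
  by rewrite -[LHS]row_ofK; apply/rowP => i; rewrite [LHS]mxE rowA mxE.
have symA : A^T = A by apply/matrixP => i j; rewrite !mxE symB.
have formE : \sum_v \sum_v' B v v' * x v * x v'
    = (row_of x *m A *m (row_of x)^T) 0 0.
  rewrite AE dotE; apply: eq_bigr => v _; rewrite mulr_suml.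
  by apply: eq_bigr => v' _; rewrite mulrAC.
have normE : \sum_v x v ^+ 2 = (row_of x *m (row_of x)^T) 0 0 by rewrite dotE.
rewrite formE normE; apply: symmetric_form_le => // mu.
case/eigenvalueP => y yA /rV0Pn[i yi].
apply: (eig mu (fun v => y 0 (enum_rank v))).
  by exists (enum_val i); rewrite enum_valK.
by move=> v; rewrite -rowA row_ofK yA mxE.
Qed.

(* With [s := sqrt m], apply the previous lemma to [K v v' / (s v * s v')]; the
   vertices with [m v = 0] are made eigenvectors for the eigenvalue [hi]. *)
Lemma weighted_symmetric_form_le (K : V -> V -> R) (m : V -> R) :
  (forall v v', K v v' = K v' v) -> (forall v, 0 <= m v) ->
  (forall v v', m v = 0 -> K v v' = 0) ->
  (forall mu f, (exists2 v, m v != 0 & f v != 0) ->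
     (forall v, \sum_v' K v v' * f v' = mu * (m v * f v)) -> mu <= hi) ->
  forall f, \sum_v \sum_v' K v v' * f v * f v' <= hi * \sum_v m v * f v ^+ 2.
Proof.
move=> symK m_ge0 K0 eig f; pose s v := Num.sqrt (m v).
have s_eq0 v : (s v == 0) = (m v == 0).
  by rewrite sqrtr_eq0 le_eqVlt ltNge m_ge0 orbF.
have s_sqr v : s v ^+ 2 = m v by rewrite sqr_sqrtr.
pose B v v' := K v v' / (s v * s v') + hi *+ ((v == v') && (m v == 0)).
have symB v v' : B v v' = B v' v.
  by rewrite /B symK [s v * _]mulrC eq_sym; case: eqVneq => [->|].
have KB v v' : K v v' = s v * s v' * B v v'.
  rewrite /B; have [mv|mv] := eqVneq (m v) 0.
    by rewrite K0 // (eqP (_ : s v == 0)) ?s_eq0 ?mv // !mul0r.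
  have [mv'|mv'] := eqVneq (m v') 0.
    by rewrite symK K0 // (eqP (_ : s v' == 0)) ?s_eq0 ?mv' // mulr0 !mul0r.
  by rewrite andbF addr0 mulrC divfK // mulf_neq0 ?s_eq0.
have := fin_symmetric_form_le symB.
have -> : \sum_v \sum_v' K v v' * f v * f v' =
    \sum_v \sum_v' B v v' * (s v * f v) * (s v' * f v').
  by apply: eq_bigr => v _; apply: eq_bigr => v' _; rewrite KB; ring.
have -> : \sum_v m v * f v ^+ 2 = \sum_v (s v * f v) ^+ 2.
  by apply: eq_bigr => v _; rewrite exprMn s_sqr.
apply=> mu x [v0 xv0] xE.
have BE v : m v != 0 -> \sum_v' K v v' * (x v' / s v') = s v * (mu * x v).
  move=> mv; rewrite -xE mulr_sumr; apply: eq_bigr => v' _.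
  have [mv'|mv'] := eqVneq (m v') 0.
    rewrite symK K0 // mul0r /B symK K0 // mul0r add0r.
    by rewrite (negPf mv) andbF mul0r mulr0.
  rewrite KB -!mulrA; congr (_ * _); rewrite mulrCA; congr (_ * _).
  by rewrite mulrC divfK // s_eq0.
have B0 v : m v = 0 -> hi * x v = mu * x v.
  move=> mv; rewrite -xE (bigD1 v) //= big1 => [|v' v'v].
    by rewrite /B K0 // mul0r add0r mv !eqxx addr0.
  by rewrite /B K0 // mul0r eq_sym (negPf v'v) addr0 mul0r.
have [mv0|mv0] := eqVneq (m v0) 0.
  by move/(mulIf xv0): (B0 v0 mv0) => ->.
apply: (eig mu (fun v => x v / s v)).
  by exists v0 => //; rewrite mulf_neq0 // invr_eq0 s_eq0.
move=> v; have [mv|mv] := eqVneq (m v) 0.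
  by rewrite mv mul0r mulr0 big1 // => v' _; rewrite K0 ?mul0r.
by rewrite BE // -s_sqr; field; rewrite s_eq0.
Qed.

End WeightedForms.

Section WeightedGraphs.
Variables (R : rcfType) (V : finType).
Implicit Types (e : V -> V -> R) (f : V -> R) (v : V) (l hi mu : R).

Definition weighted_graph e : Prop :=
  (forall v v', e v v' = e v' v) /\ (forall v v', 0 <= e v v').

Definition degree e v : R := \sum_v' e v v'.

Definition volume e : R := \sum_v degree e v.

Definition degree_sum e f : R := \sum_v degree e v * f v.

Definition edge_form e f : R := \sum_v \sum_v' e v v' * f v * f v'.

Definition edge_form_bound e l : Prop := forall f,
  edge_form e f <= l * degree_sum e (fun v => f v ^+ 2)
                   + (1 - l) * (degree_sum e f ^+ 2 / volume e).

Definition mixing_bound e l : Prop := forall f,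
  edge_form e f <= l * degree_sum e (fun v => f v ^+ 2)
                   + degree_sum e f ^+ 2 / volume e.

Definition eigenfunction e mu f : Prop :=
  forall v, \sum_v' e v v' * f v' = mu * (degree e v * f v).

Definition eigenvalue_bound e hi : Prop := forall mu f,
  degree_sum e f = 0 -> (exists2 v, degree e v != 0 & f v != 0) ->
  eigenfunction e mu f -> mu <= hi.

Definition graph_connected e : Prop := forall v v',
  degree e v != 0 -> degree e v' != 0 -> connect [rel a b | e a b != 0] v v'.

Lemma degree_ge0 e v : weighted_graph e -> 0 <= degree e v.
Proof. by case=> _ e_ge0; apply: sumr_ge0. Qed.

Lemma degree_eq0 e v v' : weighted_graph e -> degree e v = 0 -> e v v' = 0.
Proof.
case=> _ e_ge0 /eqP; rewrite psumr_eq0 // => /allP/(_ v' (mem_index_enum _)).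
by move/eqP.
Qed.

Lemma degree_sumE e f : weighted_graph e ->
  degree_sum e f = \sum_v \sum_v' e v v' * f v'.
Proof.
case=> sym_e _; rewrite exchange_big; apply: eq_bigr => v _.
by rewrite mulr_suml; apply: eq_bigr => v' _; rewrite sym_e.
Qed.

Lemma degree_sum_sqr_ge0 e f :
  weighted_graph e -> 0 <= degree_sum e (fun v => f v ^+ 2).
Proof.
by move=> we; apply: sumr_ge0 => v _; rewrite mulr_ge0 ?sqr_ge0 ?degree_ge0.
Qed.

(* Subtracting a multiple of the rank-one form [degree_sum e f ^+ 2] gives the
   constants the eigenvalue [hi] and does not change the form on the mean-zero
   functions, so no restriction to a subspace is needed. *)
Lemma edge_form_bound_of_eigenvalue e hi : weighted_graph e -> 0 < volume e ->
  eigenvalue_bound e hi -> edge_form_bound e hi.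
Proof.
move=> we vol_gt0 eig f; pose c := (1 - hi) / volume e.
pose K v v' := e v v' - c * degree e v * degree e v'.
have rowK g v : \sum_v' K v v' * g v' =
    \sum_v' e v v' * g v' - c * degree e v * degree_sum e g.
  by rewrite mulr_sumr -sumrB; apply: eq_bigr => v' _; rewrite mulrBl !mulrA.
have symK v v' : K v v' = K v' v by rewrite /K we.1 mulrAC.
have K0 v v' : degree e v = 0 -> K v v' = 0.
  by move=> dv; rewrite /K degree_eq0 // dv mulr0 mul0r subr0.
have eigK mu g : (exists2 v, degree e v != 0 & g v != 0) ->
    (forall v, \sum_v' K v v' * g v' = mu * (degree e v * g v)) -> mu <= hi.
  move=> g_neq0 gE; have [mean0|mean_neq0] := eqVneq (degree_sum e g) 0.
    by apply: (eig mu g mean0 g_neq0) => v; rewrite -gE rowK mean0 mulr0 subr0.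
  have : \sum_v \sum_v' K v v' * g v' = mu * degree_sum e g.
    by rewrite mulr_sumr; apply: eq_bigr => v _.
  under eq_bigr do rewrite rowK.
  rewrite sumrB -degree_sumE // -mulr_suml -mulr_sumr -/(volume e).
  rewrite divfK ?gt_eqF //.
  by rewrite -{1}[degree_sum e g]mul1r -mulrBl subKr => /(mulIf mean_neq0) ->.
have := weighted_symmetric_form_le symK (fun v => degree_ge0 v we) K0 eigK f.
have -> : \sum_v \sum_v' K v v' * f v * f v' =
    edge_form e f - c * degree_sum e f ^+ 2.
  transitivity (\sum_v f v * \sum_v' K v v' * f v').
    apply: eq_bigr => v _; rewrite mulr_sumr.
    by apply: eq_bigr => v' _; rewrite mulrCA mulrA.
  under eq_bigr do rewrite rowK mulrBr.
  rewrite sumrB; congr (_ - _).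
    apply: eq_bigr => v _; rewrite mulr_sumr.
    by apply: eq_bigr => v' _; rewrite mulrCA mulrA.
  rewrite expr2 mulrA [c * _]mulr_sumr mulr_suml.
  by apply: eq_bigr => v _; ring.
rewrite -/(degree_sum e (fun v => f v ^+ 2)) lerBlDr /c -mulrA.
by rewrite [_^-1 * _]mulrC.
Qed.

Lemma edge_form_bound0 e l :
  (forall v v', e v v' = 0) -> edge_form_bound e l.
Proof.
move=> e0 f; have deg0 v : degree e v = 0 by apply: big1.
rewrite /edge_form /degree_sum big1 => [|v _]; last first.
  by rewrite big1 // => v' _; rewrite e0 !mul0r.
by rewrite !big1 ?expr0n ?mul0r ?mulr0 ?addr0 // => v _; rewrite deg0 mul0r.
Qed.

Lemma mixing_bound_of_edge_form_bound e l l' : weighted_graph e ->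
  0 <= l <= l' -> edge_form_bound e l -> mixing_bound e l'.
Proof.
move=> we /andP[l_ge0 ll'] bound f; apply: le_trans (bound f) _; apply: lerD.
  by apply: ler_wpM2r => //; exact: degree_sum_sqr_ge0.
rewrite ler_piMl ?gerBl // divr_ge0 ?sqr_ge0 //.
by apply: sumr_ge0 => v _; exact: degree_ge0.
Qed.

Lemma eigenvalue_bound_scale e e' c hi : c != 0 ->
  (forall v v', e' v v' = c * e v v') ->
  eigenvalue_bound e hi -> eigenvalue_bound e' hi.
Proof.
move=> c_neq0 e'E eig mu f mean0 [v0 dv0 fv0] fE.
have degE v : degree e' v = c * degree e v.
  by rewrite mulr_sumr; apply: eq_bigr => v' _.
apply: (eig mu f); last 1 first.
- move=> v; apply: (mulfI c_neq0).
  rewrite mulrCA [c * (_ * f v)]mulrA -degE -fE mulr_sumr.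
  by apply: eq_bigr => v' _; rewrite e'E mulrA.
- apply: (mulfI c_neq0); rewrite mulr0 -mean0 mulr_sumr.
  by apply: eq_bigr => v _; rewrite degE mulrA.
- by exists v0 => //; move: dv0; rewrite degE mulf_eq0 negb_or c_neq0.
Qed.

Lemma edge_form_eigenfunction e mu f : eigenfunction e mu f ->
  edge_form e f = mu * degree_sum e (fun v => f v ^+ 2).
Proof.
move=> fE; rewrite mulr_sumr; apply: eq_bigr => v _.
transitivity (f v * \sum_v' e v v' * f v'); last by rewrite fE; ring.
by rewrite mulr_sumr; apply: eq_bigr => v' _; rewrite mulrCA mulrA.
Qed.

Lemma dirichlet_formE e f : weighted_graph e ->
  \sum_v \sum_v' e v v' * (f v - f v') ^+ 2 =
  2 * (degree_sum e (fun v => f v ^+ 2) - edge_form e f).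
Proof.
move=> we; have fstE : \sum_v \sum_v' e v v' * f v ^+ 2 =
    degree_sum e (fun v => f v ^+ 2).
  by apply: eq_bigr => v _; rewrite -mulr_suml.
have -> : 2 * (degree_sum e (fun v => f v ^+ 2) - edge_form e f) =
    degree_sum e (fun v => f v ^+ 2) - 2 * edge_form e f
      + degree_sum e (fun v => f v ^+ 2) by ring.
rewrite -{1}fstE degree_sumE // mulr_sumr -sumrB -big_split.
apply: eq_bigr => v _; rewrite mulr_sumr -sumrB -big_split.
by apply: eq_bigr => v' _ /=; ring.
Qed.

Lemma const_of_dirichlet_le0 e f : weighted_graph e -> graph_connected e ->
  \sum_v \sum_v' e v v' * (f v - f v') ^+ 2 <= 0 ->
  forall v v', degree e v != 0 -> degree e v' != 0 -> f v = f v'.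
Proof.
move=> [_ e_ge0] conn le0 v v' dv dv'.
have term_ge0 a b : 0 <= e a b * (f a - f b) ^+ 2.
  by rewrite mulr_ge0 ?sqr_ge0.
have row_ge0 a : 0 <= \sum_b e a b * (f a - f b) ^+ 2 by apply: sumr_ge0.
have edge_const a b : e a b != 0 -> f a = f b.
  have /eqP : \sum_a \sum_b e a b * (f a - f b) ^+ 2 = 0.
    by apply/eqP; rewrite eq_le le0 sumr_ge0.
  rewrite psumr_eq0 // => /allP/(_ a (mem_index_enum _)) /=.
  rewrite psumr_eq0 // => /allP/(_ b (mem_index_enum _)) /=.
  by rewrite mulf_eq0 sqrf_eq0 subr_eq0 => /orP[/eqP->|/eqP->]; rewrite ?eqxx.
have /connectP[p] := conn v v' dv dv'.
elim: p v {dv} => [|a p IH] v /=; first by move=> _ ->.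
by case/andP=> /edge_const -> /IH{}IH /IH.
Qed.

Lemma eigenvalue_lt1 e mu f : weighted_graph e -> graph_connected e ->
  degree_sum e f = 0 -> (exists2 v, degree e v != 0 & f v != 0) ->
  eigenfunction e mu f -> mu < 1.
Proof.
move=> we conn mean0 [v0 dv0 fv0] fE; rewrite ltNge; apply/negP => mu_ge1.
have fc : forall v v', degree e v != 0 -> degree e v' != 0 -> f v = f v'.
  apply: const_of_dirichlet_le0 => //.
  rewrite dirichlet_formE // (edge_form_eigenfunction fE).
  rewrite -{1}[degree_sum _ _]mul1r -mulrBl pmulr_rle0 // mulr_le0_ge0 //.
    by rewrite subr_le0.
  exact: degree_sum_sqr_ge0.
have : degree_sum e f = volume e * f v0.
  rewrite mulr_suml; apply: eq_bigr => v _.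
  by have [->|dv] := eqVneq (degree e v) 0; rewrite ?mul0r // (fc v v0).
rewrite mean0 => /esym/eqP; rewrite mulf_eq0 (negPf fv0) orbF psumr_eq0.
  by move/allP/(_ v0 (mem_index_enum _)); rewrite /= (negPf dv0).
by move=> v _; exact: degree_ge0.
Qed.

(* Oppenheim's trickling-down argument, with [loc a] the graph of the link of
   the vertex [a]: localise an eigenfunction to the links and average. *)
Lemma eigenvalue_bound_trickle e (loc : V -> V -> V -> R) l :
  weighted_graph e -> graph_connected e ->
  (forall v v', \sum_a loc a v v' = e v v') ->
  (forall a v, degree (loc a) v = e a v) ->
  l < 1 -> (forall a, edge_form_bound (loc a) l) ->
  eigenvalue_bound e (l / (1 - l)).
Proof.
move=> we conn sum_loc deg_loc l_lt1 bound_loc mu f mean0 f_neq0 fE.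
have mu_lt1 := eigenvalue_lt1 we conn mean0 f_neq0 fE.
pose S := degree_sum e (fun v => f v ^+ 2).
have S_gt0 : 0 < S.
  have [v0 dv0 fv0] := f_neq0.
  rewrite /S /degree_sum (bigD1 v0) //= ltr_pwDl //.
    by rewrite mulr_gt0 ?lt_def ?dv0 ?degree_ge0 // sqrf_eq0 fv0 sqr_ge0.
  by apply: sumr_ge0 => v _; rewrite mulr_ge0 ?sqr_ge0 ?degree_ge0.
have form_loc : \sum_a edge_form (loc a) f = mu * S.
  rewrite -(edge_form_eigenfunction fE) exchange_big; apply: eq_bigr => v _.
  rewrite exchange_big; apply: eq_bigr => v' _.
  by rewrite -sum_loc !mulr_suml.
have sqr_loc : \sum_a degree_sum (loc a) (fun v => f v ^+ 2) = S.
  rewrite /S degree_sumE //; apply: eq_bigr => a _.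
  by apply: eq_bigr => v _; rewrite deg_loc.
have mean_loc a : degree_sum (loc a) f ^+ 2 / volume (loc a) =
    mu ^+ 2 * (degree e a * f a ^+ 2).
  have -> : degree_sum (loc a) f = mu * (degree e a * f a).
    by rewrite -fE; apply: eq_bigr => v _; rewrite deg_loc.
  have -> : volume (loc a) = degree e a by exact: eq_bigr.
  have [->|da] := eqVneq (degree e a) 0; first by rewrite invr0 !mul0r !mulr0.
  by field.
have : mu * S <= l * S + (1 - l) * (mu ^+ 2 * S).
  rewrite -form_loc -[in l * _]sqr_loc [mu ^+ 2 * _]mulr_sumr.
  rewrite !mulr_sumr -big_split.
  by apply: ler_sum => a _ /=; rewrite -mean_loc; exact: bound_loc.
rewrite mulrA -mulrDl ler_pM2r // ler_pdivlMr ?subr_gt0 // => mu_le.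
rewrite -subr_ge0 -(pmulr_rge0 _ (_ : 0 < 1 - mu)) ?subr_gt0 //.
have -> : (1 - mu) * (l - mu * (1 - l)) = l + (1 - l) * mu ^+ 2 - mu by ring.
by rewrite subr_ge0.
Qed.

End WeightedGraphs.

Section Sets.
Variable V : finType.
Implicit Types (x y z u t : {set V}) (v : V).

Lemma setDKU z y : z \subset y -> (y :\: z) :|: z = y.
Proof. by move=> zy; rewrite setUC -{1}(setIidPr zy) setID. Qed.

Lemma setD_disjoint z y : (y :\: z) :&: z = set0.
Proof. by rewrite setIDAC setDIl setDv setI0. Qed.

Lemma setUDK_disjoint z x : x :&: z = set0 -> (x :|: z) :\: z = x.
Proof.
by move/eqP; rewrite setI_eq0 setDUl setDv setU0 => /setDidPl.
Qed.

Lemma cardsU_disjoint z x : x :&: z = set0 -> #|x :|: z| = (#|x| + #|z|)%N.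
Proof. by move=> xz; rewrite cardsU xz cards0 subn0. Qed.

Lemma cards_interval u t n : u \subset t -> (#|u| <= n)%N ->
  #|[set y : {set V} | [&& u \subset y, y \subset t & #|y| == n]]|
  = 'C(#|t| - #|u|, n - #|u|).
Proof.
move=> ut un; rewrite -(cardsDS ut) -cards_draws.
rewrite -(card_in_imset (f := fun y => y :\: u)) => [|y y']; last first.
  rewrite !inE => /and3P[uy _ _] /and3P[uy' _ _] yy'.
  by rewrite -(setDKU uy) yy' setDKU.
congr #|pred_of_set _|; apply/setP => s; rewrite inE.
apply/imsetP/andP => [[y]|[]].
  rewrite inE => /and3P[uy yt /eqP yn] ->.
  by rewrite setSD // cardsDS // yn.
rewrite subsetD -setI_eq0 => /andP[st /eqP su] /eqP sn; exists (s :|: u).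
  by rewrite inE subsetUr subUset st ut cardsU_disjoint // sn subnK /=.
by rewrite setUDK_disjoint.
Qed.

Lemma big_setU1 (A : nmodType) u (G : {set V} -> A) :
  \sum_(v | v \notin u) G (v |: u) =
  \sum_(y : {set V} | (u \subset y) && (#|y| == #|u|.+1)) G y.
Proof.
rewrite (eq_bigl (fun v => v \in ~: u)) => [|v]; last by rewrite inE.
rewrite -(big_imset G (h := fun v => v |: u)) => [|v v' /=]; last first.
  rewrite !inE => vu v'u /setP/(_ v).
  by rewrite !inE eqxx (negPf vu) !orbF => /esym/eqP.
apply: eq_bigl => y; apply/imsetP/andP => [[v]|[uy /eqP yu]].
  by rewrite inE => vu ->; rewrite subsetUr cardsU1 vu.
have /cards1P[v yuv] : #|y :\: u| == 1%N by rewrite cardsDS // yu subSnn.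
exists v; last by rewrite -yuv setDKU.
by have : v \in y :\: u; [rewrite yuv set11 | rewrite !inE => /andP[]].
Qed.

Lemma sum_setU1 (A : nmodType) (G : {set V} -> V -> A) :
  \sum_(u : {set V}) \sum_(v | v \notin u) G u v =
  \sum_(x : {set V}) \sum_(v in x) G (x :\ v) v.
Proof.
rewrite (exchange_big_dep xpredT) //= [RHS](exchange_big_dep xpredT) //=.
apply: eq_bigr => v _.
rewrite (reindex_onto (fun x => x :\ v) (fun u => v |: u)) => [|u vu] /=.
  apply: eq_bigl => x; rewrite !inE eqxx /=.
  by apply/eqP/idP => [<-|vx]; [rewrite setU11 | rewrite setD1K].
exact: setU1K.
Qed.

End Sets.

Section Complexes.
Variables (V : finType) (X : {set {set V}}) (d : nat).
Hypothesis hX : is_dcomplex d X.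
Implicit Types (x y z u t : {set V}).

Lemma face_subset x y : y \in X -> x \subset y -> x \in X.
Proof. by case: hX => _ sub_closed _; apply: sub_closed. Qed.

Lemma set0_face : set0 \in X.
Proof. by case: hX. Qed.

Lemma card_face_le x : x \in X -> (#|x| <= d.+1)%N.
Proof.
by case: hX => _ _ pure /pure[t _ /andP[/eqP <-]]; exact: subset_leq_card.
Qed.

Definition facet_degree x : nat := #|[set t in faces X d.+1 | x \subset t]|.

Lemma facet_degree_gt0 x : (0 < facet_degree x)%N = (x \in X).
Proof.
apply/card_gt0P/idP => [[t]|xX].
  by rewrite !inE => /andP[/andP[tX _] xt]; apply: face_subset xt.
by case: hX => _ _ /(_ x xX)[t tX /andP[td xt]]; exists t; rewrite !inE tX td.
Qed.

Lemma facet_degree_set0 : facet_degree set0 = #|faces X d.+1|.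
Proof.
by congr #|pred_of_set _|; apply/setP => t; rewrite !inE sub0set andbT.
Qed.

Lemma facets_gt0 : (0 < #|faces X d.+1|)%N.
Proof. by rewrite -facet_degree_set0 facet_degree_gt0 set0_face. Qed.

Lemma sum_facet_degree_sup u n : (#|u| <= n)%N ->
  (\sum_(y in faces X n | u \subset y) facet_degree y
   = 'C(d.+1 - #|u|, n - #|u|) * facet_degree u)%N.
Proof.
move=> un; under eq_bigr do rewrite /facet_degree -sum1_card.
rewrite (exchange_big_dep (mem [set t in faces X d.+1 | u \subset t])) /=.
  rewrite mulnC [facet_degree u]/facet_degree -sum_nat_const.
  apply: eq_bigr => t; rewrite !inE => /andP[/andP[tX /eqP td] ut].
  rewrite -td -cards_interval // sum1dep_card.
  apply: eq_card => y; rewrite !inE tX td eqxx /=.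
  case: (boolP (y \subset t)) => [yt|]; rewrite ?andbF //=.
  by rewrite (face_subset tX yt) andbT andbC.
move=> y t /andP[_ uy]; rewrite !inE => /andP[-> yt] /=.
exact: subset_trans uy yt.
Qed.

Lemma in_link z x : (x \in link X z) = (x :&: z == set0) && (x :|: z \in X).
Proof.
apply/imsetP/andP => [[y]|[/eqP xz xX]].
  by rewrite inE => /andP[yX zy] ->; rewrite setD_disjoint setDKU.
by exists (x :|: z); rewrite ?inE ?xX ?subsetUr // setUDK_disjoint.
Qed.

Lemma link_disjoint z x : x \in link X z -> x :&: z = set0.
Proof. by rewrite in_link => /andP[/eqP]. Qed.

Lemma set1_link z (v : V) :
  ([set v] \in link X z) = (v \notin z) && (v |: z \in X).
Proof. by rewrite in_link setI_eq0 disjoints1. Qed.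

Lemma set2_link z (v v' : V) : ([set v; v'] \in link X z) =
  [&& v \notin z, v' \notin z & v |: (v' |: z) \in X].
Proof.
by rewrite in_link setIUl setU_eq0 !setI_eq0 !disjoints1 -setUA -andbA.
Qed.

Lemma link_setD z y : y \in X -> z \subset y -> y :\: z \in link X z.
Proof. by move=> yX zy; rewrite in_link setD_disjoint eqxx setDKU. Qed.

Lemma big_link_faces (A : nmodType) z n (P : pred {set V}) (G : {set V} -> A) :
  \sum_(x in faces (link X z) n | P x) G x =
  \sum_(y in faces X (n + #|z|) | (z \subset y) && P (y :\: z)) G (y :\: z).
Proof.
rewrite (reindex_onto (fun y => y :\: z) (fun x => x :|: z)) /=; last first.
  move=> x /andP[]; rewrite inE => /andP[/link_disjoint xz _] _.
  exact: setUDK_disjoint.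
apply: eq_bigl => y; rewrite inE in_link [in RHS]inE setD_disjoint eqxx /=.
have [zy|zy] /= := boolP (z \subset y); last first.
  by rewrite andbF; apply: contraNF zy => /andP[_ /eqP <-]; exact: subsetUr.
rewrite setDKU // eqxx andbT cardsDS // -(eqn_add2r #|z|) subnK //.
exact: subset_leq_card.
Qed.

End Complexes.
Arguments facet_degree {V} X d x.

Section Links.
Variables (V : finType) (X : {set {set V}}) (d : nat).
Hypothesis hX : is_dcomplex d X.
Variable z : {set V}.
Hypotheses (zX : z \in X) (zd : (#|z| <= d)%N).
Implicit Types (x y : {set V}).

Lemma link_subset x y : y \in link X z -> x \subset y -> x \in link X z.
Proof.
rewrite !in_link => /andP[/eqP yz yX] xy; apply/andP; split.
  by rewrite -subset0 -yz setSI.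
by apply: (face_subset hX yX); rewrite setSU.
Qed.

Lemma link_dcomplex : is_dcomplex (d - #|z|) (link X z).
Proof.
split=> [||x]; first by rewrite in_link set0I eqxx set0U.
  exact: link_subset.
move=> xl; have := xl; rewrite in_link => /andP[/eqP xz xX].
have [_ _ /(_ _ xX)[t tX]] := hX; rewrite subUset => /and3P[/eqP td xt zt].
exists (t :\: z); first exact: link_setD.
by rewrite cardsDS // td subSn // eqxx subsetD xt -setI_eq0 xz /=.
Qed.

Lemma facet_degree_link x : x :&: z = set0 ->
  facet_degree (link X z) (d - #|z|) x = facet_degree X d (x :|: z).
Proof.
move=> xz; rewrite /facet_degree -[LHS]sum1_card -[RHS]sum1_card.
rewrite (eq_bigl (fun y =>
  (y \in faces (link X z) (d - #|z|).+1) && (x \subset y))); last first.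
  by move=> y; rewrite inE.
rewrite [LHS]big_link_faces addSn subnK //.
apply: eq_bigl => y; rewrite [RHS]inE subUset; apply: andb_id2l => _.
by rewrite subsetD -setI_eq0 xz eqxx andbT andbC.
Qed.

End Links.

Lemma fact_neq0 (R : numDomainType) n : n`!%:R != 0 :> R.
Proof. by rewrite pnatr_eq0 -lt0n fact_gt0. Qed.

Section FlagWeights.
Variables (R : realType) (V : finType).
Implicit Types (X : {set {set V}}) (x y z u : {set V}).

(* The probability that a uniformly random ordered facet starts with a given
   ordering of [x]: in this normalisation passing to a link is conditioning. *)
Definition flag_weight d X x : R := weight R d X x / #|x|`!%:R.

Variables (X : {set {set V}}) (d : nat).
Hypothesis hX : is_dcomplex d X.
Local Notation w := (weight R d X).
Local Notation fw := (flag_weight d X).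

Lemma weight_ge0 x : 0 <= w x.
Proof. by rewrite /weight !mulr_ge0 ?invr_ge0. Qed.

Lemma weight_eq0 x : x \notin X -> w x = 0.
Proof.
rewrite -(facet_degree_gt0 hX) -eqn0Ngt /facet_degree /weight => /eqP ->.
by rewrite mulr0.
Qed.

Lemma flag_weight_ge0 x : 0 <= fw x.
Proof. by rewrite divr_ge0 ?weight_ge0. Qed.

Lemma flag_weight_eq0 x : x \notin X -> fw x = 0.
Proof. by move=> xX; rewrite /flag_weight weight_eq0 // mul0r. Qed.

Lemma weightE x : w x = #|x|`!%:R * fw x.
Proof. by rewrite mulrC divfK // fact_neq0. Qed.

Lemma flag_weightE x : (#|x| <= d.+1)%N ->
  fw x = (d.+1 - #|x|)`!%:R / (d.+1`!%:R * #|faces X d.+1|%:R)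
         * (facet_degree X d x)%:R.
Proof.
move=> xd; rewrite /flag_weight /weight -(bin_fact xd) !natrM.
rewrite -/(facet_degree X d x).
by field; rewrite !pnatr_eq0 -!lt0n !fact_gt0 bin_gt0 xd (facets_gt0 hX).
Qed.

Lemma flag_weight_gt0 x : x \in X -> 0 < fw x.
Proof.
move=> xX; have xd := card_face_le hX xX.
rewrite flag_weightE // mulr_gt0 ?divr_gt0 ?mulr_gt0 ?ltr0n ?fact_gt0 //.
  exact: facets_gt0 hX.
by rewrite (facet_degree_gt0 hX).
Qed.

Lemma flag_weight_set0 : fw set0 = 1.
Proof.
rewrite flag_weightE cards0 // subn0 facet_degree_set0.
by field; rewrite !pnatr_eq0 -!lt0n fact_gt0 (facets_gt0 hX).
Qed.

Lemma sum_flag_weight_sup u n : (#|u| <= n <= d.+1)%N ->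
  \sum_(y in faces X n | u \subset y) fw y = fw u / (n - #|u|)`!%:R.
Proof.
case/andP=> un nd; have ud := leq_trans un nd.
transitivity (\sum_(y in faces X n | u \subset y)
   (d.+1 - n)`!%:R / (d.+1`!%:R * #|faces X d.+1|%:R)
     * (facet_degree X d y)%:R : R).
  apply: eq_bigr => y; rewrite inE => /andP[/andP[_ /eqP yn] _].
  by rewrite flag_weightE yn.
rewrite -mulr_sumr -natr_sum (sum_facet_degree_sup hX) //.
rewrite [(_ * facet_degree _ _ _)%:R]natrM flag_weightE //.
move: (d.+1`!%:R : R) (fact_neq0 R d.+1) => D D_neq0.
have -> : (d.+1 - n = (d.+1 - #|u|) - (n - #|u|))%N by lia.
have nu : (n - #|u| <= d.+1 - #|u|)%N by lia.
rewrite -[in RHS](bin_fact nu) !natrM.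
by field; rewrite D_neq0 fact_neq0 pnatr_eq0 -lt0n (facets_gt0 hX).
Qed.

Lemma sum_flag_weight_setU1 u : (#|u| <= d)%N ->
  \sum_(v | v \notin u) fw (v |: u) = fw u.
Proof.
move=> ud; rewrite big_setU1 -[RHS]divr1 -[1]/(1`!%:R) -(subSnn #|u|).
rewrite -sum_flag_weight_sup ?leqnSn // big_mkcond [RHS]big_mkcond.
apply: eq_bigr => y _; rewrite inE; have [yX|yX] := boolP (y \in X) => /=.
  by rewrite andbC.
by rewrite flag_weight_eq0 ?if_same.
Qed.

End FlagWeights.

Section TotalWeight.
Variables (R : realType) (V : finType).
Implicit Types (X : {set {set V}}) (P Q : pred {set V}) (d n : nat).

Definition total_weight d X n P : R :=
  \sum_(x in faces X n | P x) weight R d X x.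

Lemma total_weight_ge0 d X n P : 0 <= total_weight d X n P.
Proof. by apply: sumr_ge0 => x _; exact: weight_ge0. Qed.

Lemma total_weight_indicator d X n P :
  total_weight d X n P = \sum_(x in faces X n) (P x)%:R * weight R d X x.
Proof.
rewrite /total_weight big_mkcondr; apply: eq_bigr => x _.
by case: (P x); rewrite ?mul1r ?mul0r.
Qed.

Lemma eq_total_weight d X n P Q : {in faces X n, P =1 Q} ->
  total_weight d X n P = total_weight d X n Q.
Proof. by move=> PQ; apply: eq_bigl => x; apply: andb_id2l => /PQ. Qed.

Variables (X : {set {set V}}) (d : nat).
Hypothesis hX : is_dcomplex d X.

Lemma total_weight_predT n : (n <= d.+1)%N -> total_weight d X n xpredT = 1.
Proof.
move=> nd; have c0 := cards0 V.
rewrite -(flag_weight_set0 R hX) -[RHS](divfK (fact_neq0 R n)).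
rewrite -[in n`!](subn0 n) -c0 -sum_flag_weight_sup // ?c0 // mulr_suml.
apply: eq_big => [x|x]; first by rewrite sub0set.
by rewrite inE andbT => /andP[_ /eqP <-]; rewrite weightE mulrC subn0.
Qed.

Lemma total_weight_le1 n P : (n <= d.+1)%N -> total_weight d X n P <= 1.
Proof.
move/total_weight_predT <-; rewrite !total_weight_indicator.
apply: ler_sum => x _.
by apply: ler_wpM2r; rewrite ?weight_ge0 // ler_nat leq_b1.
Qed.

Variable z : {set V}.
Hypotheses (zX : z \in X) (zd : (#|z| <= d)%N).

Lemma flag_weight_link x : x \in link X z ->
  flag_weight R (d - #|z|) (link X z) x =
  flag_weight R d X (x :|: z) / flag_weight R d X z.
Proof.
move=> xl; have := xl; rewrite in_link => /andP[/eqP xz xX].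
have link_dc := link_dcomplex hX zX zd.
have xzd := card_face_le hX xX; rewrite cardsU_disjoint // in xzd.
rewrite (flag_weightE _ link_dc) ?(card_face_le link_dc) //.
rewrite !(flag_weightE _ hX) ?cardsU_disjoint ?(leqW zd) //.
rewrite -(facet_degree_set0 _ (d - #|z|)%N) !facet_degree_link ?set0I // set0U.
have -> : (d.+1 - (#|x| + #|z|) = (d - #|z|).+1 - #|x|)%N by lia.
rewrite -subSn //.
move: (d.+1`!%:R) (fact_neq0 R d.+1) => D D_neq0.
field; rewrite D_neq0 !fact_neq0 !pnatr_eq0 -!lt0n.
by rewrite (facets_gt0 hX) (facet_degree_gt0 hX) zX.
Qed.

Lemma total_weight_link n P : total_weight (d - #|z|) (link X z) n P =
  n`!%:R / ((n + #|z|)`!%:R * flag_weight R d X z) *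
    total_weight d X (n + #|z|) (fun y => (z \subset y) && P (y :\: z)).
Proof.
rewrite /total_weight big_link_faces mulr_sumr; apply: eq_bigr => y.
case/and3P; rewrite inE => /andP[yX /eqP yn] zy _.
rewrite !weightE flag_weight_link ?link_setD // setDKU // cardsDS // yn addnK.
by field; rewrite !fact_neq0 gt_eqF // flag_weight_gt0.
Qed.

End TotalWeight.

Section LinkGraphs.
Variables (R : realType) (V : finType).
Implicit Types (X : {set {set V}}) (u : {set V}) (a v : V).

Definition vertex_weight d X u v : R :=
  if v \notin u then flag_weight R d X (v |: u) else 0.

(* The weighted 1-skeleton of the link of [u], scaled by [flag_weight u]. *)
Definition link_graph d X u v v' : R :=
  if v' \notin u then vertex_weight d X (v' |: u) v else 0.

Variables (X : {set {set V}}) (d : nat).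
Hypothesis hX : is_dcomplex d X.

Local Notation fw := (flag_weight R d X).
Local Notation vw := (vertex_weight d X).
Local Notation lg := (link_graph d X).

Lemma vertex_weight_ge0 u v : 0 <= vw u v.
Proof.
by rewrite /vertex_weight; case: ifP => // _; exact: flag_weight_ge0.
Qed.

Lemma vertex_weight_neq0 u v : (vw u v != 0) = (v \notin u) && (v |: u \in X).
Proof.
rewrite /vertex_weight; case: ifP => _ /=; last by rewrite eqxx.
have [vX|vX] := boolP (v |: u \in X); first by rewrite gt_eqF ?flag_weight_gt0.
by rewrite flag_weight_eq0 ?eqxx.
Qed.

Lemma link_graphE u v v' : lg u v v' =
  if [&& v \notin u, v' \notin u & v != v'] then fw (v |: (v' |: u)) else 0.
Proof.
rewrite /link_graph /vertex_weight !inE negb_or.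
by case: (v' \in u); case: (v \in u); case: (v != v').
Qed.

Lemma link_graph_neq0 u v v' : (lg u v v' != 0) =
  [&& v \notin u, v' \notin u, v != v' & v |: (v' |: u) \in X].
Proof.
rewrite /link_graph; case: ifP => v'u; rewrite ?eqxx ?andbF //.
by rewrite vertex_weight_neq0 !inE negb_or -!andbA andbCA.
Qed.

Lemma link_graph_eq0 u v v' : u \notin X -> lg u v v' = 0.
Proof.
move=> uX; apply/eqP; apply: contraNT uX; rewrite link_graph_neq0.
case/and4P=> _ _ _ /(face_subset hX); apply.
by rewrite setUA subsetUr.
Qed.

Lemma weighted_link_graph u : weighted_graph (lg u).
Proof.
split=> v v'; first by rewrite !link_graphE [v' == v]eq_sym andbCA setUCA.
by rewrite /link_graph; case: ifP => // _; exact: vertex_weight_ge0.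
Qed.

Lemma sum_vertex_weight u : (#|u| <= d)%N -> \sum_v vw u v = fw u.
Proof. by move=> ud; rewrite -sum_flag_weight_setU1 // [RHS]big_mkcond. Qed.

Lemma degree_link_graph u v : (#|u| < d)%N -> degree (lg u) v = vw u v.
Proof.
move=> ud; have [sym _] := weighted_link_graph u.
rewrite /degree; under eq_bigr do rewrite sym.
rewrite /link_graph /vertex_weight; case: ifPn => vu; last by rewrite big1.
by rewrite sum_vertex_weight // cardsU1 vu.
Qed.

Lemma volume_link_graph u : (#|u| < d)%N -> volume (lg u) = fw u.
Proof.
move=> ud; rewrite -sum_vertex_weight ?(ltnW ud) //.
by apply: eq_bigr => v _; rewrite degree_link_graph.
Qed.

Lemma sum_link_graph_setU1 u v v' : (#|u|.+1 < d)%N ->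
  \sum_(a | a \notin u) lg (a |: u) v v' = lg u v v'.
Proof.
move=> ud; rewrite [in RHS]link_graphE.
case: ifPn => [/and3P[vu v'u vv']|nvv']; last first.
  rewrite big1 // => a au; rewrite link_graphE ifN //; apply: contra nvv'.
  by rewrite !inE !negb_or => /and3P[/andP[_ ->] /andP[_ ->] ->].
have card_vv'u : #|v |: (v' |: u)| = #|u|.+2.
  by rewrite !cardsU1 !inE negb_or vu v'u vv'.
rewrite -sum_vertex_weight ?card_vv'u // big_mkcond; apply: eq_bigr => a _.
rewrite link_graphE /vertex_weight !inE !negb_or vu v'u vv' !andbT.
rewrite [v == a]eq_sym [v' == a]eq_sym.
case: (a \in u); rewrite /= ?andbF //= andbT.
by case: ifP => // _; rewrite [v' |: (a |: u)]setUCA [v |: (a |: _)]setUCA.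
Qed.

Lemma link_graph_connected u : (#|u| < d)%N ->
  connected_complex (link X u) -> graph_connected (lg u).
Proof.
move=> ud conn v v'.
rewrite !degree_link_graph // !vertex_weight_neq0 -!set1_link => vX v'X.
apply: connect_sub (conn v v' vX v'X) => a b.
rewrite /adj /= set2_link => /and3P[au bu abX]; have [->//|ab] := eqVneq a b.
by apply: connect1; rewrite /= link_graph_neq0 au bu ab.
Qed.

End LinkGraphs.

Section SpectralExpanders.
Variables (R : realType) (V : finType) (X : {set {set V}}) (d : nat).
Hypothesis hX : is_dcomplex d X.
Implicit Types (u : {set V}) (v : V) (f : V -> R).

Local Notation fw := (flag_weight R d X).
Local Notation lg := (@link_graph R V d X).

Lemma sum_faces1 (G : {set V} -> R) : (forall x, x \notin X -> G x = 0) ->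
  \sum_(x in faces X 1) G x = \sum_v G [set v].
Proof.
move=> G0; transitivity (\sum_(v | v \notin (set0 : {set V})) G (v |: set0)).
  rewrite big_setU1 cards0 big_mkcond [RHS]big_mkcond; apply: eq_bigr => x _.
  by rewrite inE sub0set; have [//|/G0 ->] := boolP (x \in X); rewrite if_same.
by apply: eq_big => v; rewrite ?inE // setU0.
Qed.

Lemma adjacency1 (F : {set V} -> R) v : (0 < d)%N ->
  adjacency d X F [set v] =
  (\sum_v' lg set0 v v' * F [set v']) / degree (lg set0) v.
Proof.
move=> d_gt0; rewrite degree_link_graph ?cards0 // /vertex_weight inE setU0.
pose G x := weight R d X x / (2 * weight R d X [set v]) * F (x :\: [set v]).
transitivity (\sum_(v' | v' \notin [set v]) G (v' |: [set v])).
  rewrite (big_setU1 [set v] G) cards1 /adjacency big_mkcond [RHS]big_mkcond.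
  apply: eq_bigr => x _; rewrite inE andbC /G; have [//|xX] := boolP (x \in X).
  by rewrite weight_eq0 // !mul0r !if_same.
rewrite big_mkcond mulr_suml; apply: eq_bigr => v' _.
rewrite !inE link_graphE /G !inE eq_sym /=.
case: ifPn => vv'; last by rewrite !mul0r.
have -> : (v' |: [set v]) :\: [set v] = [set v'].
  apply/setUDK_disjoint/eqP.
  by rewrite setI_eq0 disjoints1 inE eq_sym.
rewrite !weightE cards1 cards2 eq_sym vv' setU0 mul1r setUC.
move: (fw [set v]) (fw [set v; v']) => a b.
by rewrite invfM -!mulrA mulrCA mulVKf ?pnatr_eq0 // [a^-1 * _]mulrC.
Qed.

Lemma eigenvalue_bound_of_spectral_expander lo hi : (0 < d)%N ->
  spectral_expander d X lo hi -> eigenvalue_bound (lg set0) hi.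
Proof.
move=> d_gt0 spec mu f mean0 [v0 dv0 fv0] fE.
have degE v : degree (lg set0) v = weight R d X [set v].
  rewrite degree_link_graph ?cards0 // /vertex_weight inE setU0.
  by rewrite weightE cards1 mul1r.
have vX v : ([set v] \in X) = (degree (lg set0) v != 0).
  by rewrite degree_link_graph ?cards0 // vertex_weight_neq0 // inE setU0.
pose F (x : {set V}) := \sum_(v in x) f v.
have F1 v : F [set v] = f v by rewrite /F big_set1.
have /andP[_ //] : lo <= mu <= hi; apply: (spec mu F).
- rewrite /mean_zero sum_faces1 => [|x xX]; last by rewrite weight_eq0 ?mul0r.
  by rewrite -[RHS]mean0; apply: eq_bigr => v _; rewrite F1 degE.
- by exists [set v0]; rewrite ?F1 // inE vX dv0 cards1.
move=> x; rewrite inE => /andP[xX /cards1P[v xv]]; move: xX; rewrite {x}xv vX.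
move=> dv; rewrite adjacency1 // F1; under eq_bigr do rewrite F1.
by rewrite fE mulrCA mulrC mulKf.
Qed.

End SpectralExpanders.

Section TricklingDown.
Variables (R : realType) (V : finType) (X : {set {set V}}) (d : nat).
Hypothesis hX : is_dcomplex d X.
Implicit Types (u : {set V}) (v : V) (f : V -> R).

Local Notation lg := (@link_graph R V d X).

Lemma edge_form_bound_of_link_eigenvalue u hi : u \in X -> (#|u| < d)%N ->
  eigenvalue_bound (lg u) hi -> edge_form_bound (lg u) hi.
Proof.
move=> uX ud; apply: edge_form_bound_of_eigenvalue.
  exact: weighted_link_graph.
by rewrite volume_link_graph // flag_weight_gt0.
Qed.

Lemma eigenvalue_bound_of_link_expander u lo hi : u \in X -> (#|u| < d)%N ->
  spectral_expander (d - #|u|) (link X u) lo hi -> eigenvalue_bound (lg u) hi.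
Proof.
move=> uX ud spec; have link_dc := link_dcomplex hX uX (ltnW ud).
have fwu_neq0 : flag_weight R d X u != 0 by rewrite gt_eqF // flag_weight_gt0.
have d'_gt0 : (0 < d - #|u|)%N by rewrite subn_gt0.
have := eigenvalue_bound_of_spectral_expander link_dc d'_gt0 spec.
apply: (eigenvalue_bound_scale fwu_neq0) => v v'.
have [vv'X|vv'X] :=
  boolP [&& v \notin u, v' \notin u, v != v' & v |: (v' |: u) \in X].
  case/and4P: vv'X => vu v'u vv' vv'X.
  rewrite !link_graphE vu v'u vv' !inE /= setU0.
  rewrite flag_weight_link ?(ltnW ud) //; first by rewrite -setUA mulrC divfK.
  by rewrite set2_link vu v'u.
apply/eqP; move: (vv'X); rewrite -(link_graph_neq0 R hX) negbK => /eqP ->.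
rewrite eq_sym mulf_eq0 (negPf fwu_neq0) /=; apply: contraNT vv'X.
rewrite (link_graph_neq0 R link_dc) !inE setU0 set2_link.
by case/and5P=> _ _ -> -> /andP[-> ->].
Qed.

Lemma eigenvalue_bound_link_trickle u l : u \in X -> (#|u|.+1 < d)%N -> l < 1 ->
  connected_complex (link X u) ->
  (forall a, a \notin u -> a |: u \in X -> edge_form_bound (lg (a |: u)) l) ->
  eigenvalue_bound (lg u) (l / (1 - l)).
Proof.
move=> uX ud l_lt1 conn bound_loc; have ud' := ltnW ud.
pose loc a v v' := if a \notin u then lg (a |: u) v v' else 0.
apply: (eigenvalue_bound_trickle (loc := loc)) => //.
- exact: weighted_link_graph.
- exact: link_graph_connected.
- by move=> v v'; rewrite -sum_link_graph_setU1 // [RHS]big_mkcond.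
- move=> a v; have [-> _] := weighted_link_graph R X d u.
  rewrite [RHS]/link_graph /degree /loc; case: ifPn => au; last by rewrite big1.
  by rewrite -(degree_link_graph _ hX) // cardsU1 au.
move=> a; rewrite /loc; have [au|_] := boolP (a \notin u); last first.
  exact: edge_form_bound0.
have [auX|auX] := boolP (a |: u \in X); first exact: bound_loc.
by apply: edge_form_bound0 => v v'; exact: link_graph_eq0.
Qed.

Lemma edge_form_bound_of_local_expander (lo l : R) :
  (0 < d)%N -> 0 <= l -> l * d%:R <= 1 ->
  strongly_connected d X -> local_spectral_expander d X d.-1 lo l ->
  forall m u, u \in X -> (#|u| + m.+1 = d)%N ->
  edge_form_bound (lg u) (l / (1 - m%:R * l)).
Proof.
move=> d_gt0 l_ge0 ld conn loc; elim=> [|m IH] u uX um.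
  rewrite mul0r subr0 divr1; have ud : (#|u| < d)%N by lia.
  apply: edge_form_bound_of_link_eigenvalue => //.
  apply: eigenvalue_bound_of_link_expander (loc u _) => //.
  by rewrite inE uX; apply/eqP; lia.
have ud : (#|u| < d)%N by lia.
have l_small : m.+1%:R * l < 1.
  have [->|l_neq0] := eqVneq l 0; first by rewrite mulr0.
  apply: lt_le_trans ld; rewrite mulrC ltr_pM2l ?[0 < l]lt_def ?l_neq0 //.
  by rewrite ltr_nat; lia.
rewrite -natr1 mulrDl mul1r in l_small.
apply: edge_form_bound_of_link_eigenvalue => //.
have -> : l / (1 - m.+1%:R * l) = l / (1 - m%:R * l) / (1 - l / (1 - m%:R * l)).
  by rewrite -natr1; field; rewrite !gt_eqF //; lra.
apply: eigenvalue_bound_link_trickle => //; first by lia.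
- by rewrite ltr_pdivrMr ?mul1r; lra.
- exact: conn.
by move=> a au aX; apply: IH; rewrite // cardsU1 au; lia.
Qed.

Lemma mixing_bound_of_local_expander (lo l : R) u : 0 <= l -> l * d%:R <= 1 ->
  strongly_connected d X -> local_spectral_expander d X d.-1 lo l ->
  u \in X -> (#|u| < d)%N -> mixing_bound (lg u) (d%:R * l).
Proof.
move=> l_ge0 ld conn loc uX ud.
have d_gt0 : (0 < d)%N by lia.
have um : (#|u| + (d - #|u|.+1).+1 = d)%N by lia.
apply: mixing_bound_of_edge_form_bound (weighted_link_graph _ _ _ _) _
  (edge_form_bound_of_local_expander d_gt0 l_ge0 ld conn loc uX um).
have dR_gt0 : 0 < d%:R :> R by rewrite ltr0n.
have ml_le : (d - #|u|.+1)%:R * l <= 1 - d%:R^-1.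
  apply: (@le_trans _ _ ((d%:R - 1) / d%:R)); last first.
    by rewrite mulrBl mulfV ?mul1r ?gt_eqF.
  apply: ler_pM => //; last by rewrite -[d%:R^-1]mul1r ler_pdivlMr.
  by rewrite -(natrB _ d_gt0) ler_nat; lia.
have dV_gt0 : 0 < d%:R^-1 :> R by rewrite invr_gt0.
set t := _ * l in ml_le *; have t_lt1 : 0 < 1 - t by lra.
rewrite divr_ge0 ?(ltW t_lt1) //= ler_pdivrMr // mulrAC -[X in X <= _]mul1r.
by apply: ler_wpM2r => //; rewrite mulrC -ler_pdivrMr // mul1r; lra.
Qed.

End TricklingDown.

Section OrderingSigns.
Variable V : finType.
Implicit Types (u v : V) (s t : seq V) (x y z : {set V}).

Definition pair_sign u v : int := Num.sg ((enum_rank v)%:Z - (enum_rank u)%:Z).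

(* [(-1) ^+ n] for [n] the number of inversions of [t] along [enum_rank]. *)
Fixpoint ord_sign t : int :=
  if t is u :: t' then (\prod_(v <- t') pair_sign u v) * ord_sign t' else 1.

Definition del_sign u y : int := \prod_(v in y :\ u) pair_sign u v.

Definition cross_sign x z : int := \prod_(u in x) \prod_(v in z) pair_sign u v.

Lemma pair_signC u v : pair_sign v u = - pair_sign u v.
Proof. by rewrite /pair_sign -sgrN opprB. Qed.

Lemma pair_sign_sqr u v : u != v -> pair_sign u v * pair_sign u v = 1.
Proof.
move=> uv; rewrite -expr2 /pair_sign sqr_sg subr_eq0 eqz_nat.
rewrite -[_ == _]/(enum_rank v == enum_rank u) (inj_eq enum_rank_inj).
by rewrite eq_sym uv.
Qed.

Lemma prod_sqr_eq1 (I : Type) (r : seq I) (P : pred I) (E : I -> int) :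
  (forall i, P i -> E i * E i = 1) ->
  (\prod_(i <- r | P i) E i) * (\prod_(i <- r | P i) E i) = 1.
Proof. by move=> EE; rewrite -big_split /= big1. Qed.

Lemma prod_pair_sign_sqr u s : u \notin s ->
  (\prod_(v <- s) pair_sign u v) * (\prod_(v <- s) pair_sign u v) = 1.
Proof.
move=> us; rewrite big_seq; apply: prod_sqr_eq1 => v vs.
by apply: pair_sign_sqr; apply: contra us => /eqP ->.
Qed.

Lemma ord_sign_cat s t : ord_sign (s ++ t) =
  ord_sign s * (\prod_(u <- s) \prod_(v <- t) pair_sign u v) * ord_sign t.
Proof.
elim: s => [|u s IH] /=; first by rewrite big_nil !mul1r.
by rewrite IH big_cat big_cons /=; ring.
Qed.

Lemma ord_sign_sqr t : uniq t -> ord_sign t * ord_sign t = 1.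
Proof.
elim: t => [|u t IH] //= /andP[ut /IH tt].
by rewrite mulrACA tt mulr1 prod_pair_sign_sqr.
Qed.

Lemma ord_sign_del s u t : uniq (s ++ u :: t) ->
  (-1) ^+ size s * ord_sign (s ++ t) =
  ord_sign (s ++ u :: t) * \prod_(v <- s ++ t) pair_sign u v.
Proof.
rewrite uniq_catC cat_cons /= mem_cat negb_or => /andP[/andP[ut us] _].
have crossE : \prod_(a <- s) \prod_(v <- u :: t) pair_sign a v =
    (-1) ^+ size s * (\prod_(v <- s) pair_sign u v)
      * \prod_(a <- s) \prod_(v <- t) pair_sign a v.
  under eq_bigr do rewrite big_cons; rewrite big_split /=; congr (_ * _).
  elim: s {us} => [|v s IH]; first by rewrite !big_nil mulr1.
  by rewrite !big_cons IH pair_signC exprS; ring.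
have := prod_pair_sign_sqr us; have := prod_pair_sign_sqr ut.
rewrite !ord_sign_cat /= big_cat /= crossE.
set pt := \prod_(v <- t) _; set ps := \prod_(v <- s) _ => ptt pss.
set c := \prod_(a <- s) \prod_(v <- t) _; set n := (-1) ^+ _.
transitivity (n * (ord_sign s * c * ord_sign t) * (ps * ps) * (pt * pt)).
  by rewrite ptt pss !mulr1.
by ring.
Qed.

Fixpoint diff_prod (s : seq int) : int :=
  if s is a :: s' then (\prod_(b <- s') (b - a)) * diff_prod s' else 1.

Lemma diff_prodE (s : seq int) : diff_prod s =
  \prod_(i < size s) \prod_(j < size s | (i < j)%N) (s`_j - s`_i).
Proof.
elim: s => [|a s IH]; first by rewrite big_ord0.
rewrite /= big_ord_recl /=; congr (_ * _).
  rewrite [RHS]big_mkcond big_ord_recl /= mul1r (big_nth 0) big_mkord.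
  exact: eq_bigr.
rewrite IH; apply: eq_bigr => i _.
by rewrite [RHS]big_mkcond big_ord_recl /= mul1r -big_mkcond.
Qed.

Lemma ord_sign_Vandermonde n (t : n.-tuple V) : ord_sign t =
  Num.sg (\det (Vandermonde n (\row_i (enum_rank (tnth t i))%:Z))).
Proof.
pose r (u : V) : int := (enum_rank u)%:Z.
transitivity (Num.sg (diff_prod (map r t))).
  elim: (val t) => [|u s IH] /=; first by rewrite sgr1.
  rewrite sgrM -IH; congr (_ * _); rewrite big_map.
  by rewrite (big_morph Num.sg (@sgrM _) (@sgr1 _)).
rewrite diff_prodE det_Vandermonde size_map size_tuple.
congr (Num.sg _); apply: eq_bigr => i _; apply: eq_bigr => j _; rewrite !mxE.
by rewrite !(nth_map (tnth t i)) ?size_tuple // -!tnth_nth.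
Qed.

Lemma ord_sign_perm n (t : n.-tuple V) (s : 'S_n) :
  ord_sign [tuple tnth t (s i) | i < n] = (-1) ^+ s * ord_sign t.
Proof.
rewrite !ord_sign_Vandermonde.
set a := \row_i (enum_rank (tnth t i))%:Z.
set b := \row_i (enum_rank (tnth [tuple tnth t (s i) | i < n] i))%:Z.
have -> : Vandermonde n b = col_perm s (Vandermonde n a) :> 'M[int]_n.
  by apply/matrixP => i j; rewrite !mxE tnth_mktuple.
rewrite col_permE det_mulmx det_perm odd_permV mulrC sgrM; congr (_ * _).
by case: (odd_perm s); rewrite ?expr1 ?expr0 ?sgrN1 ?sgr1.
Qed.

Lemma cross_signE s t : uniq s -> uniq t ->
  \prod_(u <- s) \prod_(v <- t) pair_sign u v =
  cross_sign [set u in s] [set v in t].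
Proof.
move=> us ut; rewrite /cross_sign big_uniq //=.
apply: eq_big => [u|u _]; first by rewrite inE.
by rewrite big_uniq //=; apply: eq_bigl => v; rewrite inE.
Qed.

Lemma cross_sign_sqr x z :
  x :&: z = set0 -> cross_sign x z * cross_sign x z = 1.
Proof.
move=> xz; apply: prod_sqr_eq1 => u ux; apply: prod_sqr_eq1 => v vz.
apply: pair_sign_sqr; apply/eqP => uv.
by have := in_set0 u; rewrite -xz inE ux uv vz.
Qed.

Lemma cross_signD1 x z u : u \in x ->
  cross_sign x z = (\prod_(v in z) pair_sign u v) * cross_sign (x :\ u) z.
Proof.
move=> ux; rewrite /cross_sign (bigD1 u) //=; congr (_ * _).
by apply: eq_bigl => v; rewrite !inE andbC.
Qed.

Lemma del_signU x z u : x :&: z = set0 -> u \notin z ->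
  del_sign u (x :|: z) = del_sign u x * \prod_(v in z) pair_sign u v.
Proof.
move=> xz uz; rewrite /del_sign setDUl.
have -> : z :\ u = z by apply/setDidPl; rewrite disjoint_sym disjoints1.
have xuz : (x :\ u) :&: z = set0 by rewrite setIDAC xz set0D.
rewrite (big_setID z) /= (setUDK_disjoint xuz) (setIidPr (subsetUr _ _)).
exact: mulrC.
Qed.

Lemma mulrz_sqr1_eq0 (A : zmodType) (a : A) (c : int) : c * c = 1 ->
  (a *~ c == 0) = (a == 0).
Proof.
move=> cc; apply/eqP/eqP => [ac0|->]; last by rewrite mul0rz.
by rewrite -[a]mulr1z -cc mulrzA ac0 mul0rz.
Qed.

End OrderingSigns.

Section OrientedFamilies.
Variables (V : finType) (X : {set {set V}}) (F : aug_sheaf X).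
Hypothesis face_sub : forall x y : {set V}, y \in X -> x \subset y -> x \in X.
Implicit Types (f g : cochain F) (phi psi : forall x, F x).
Implicit Types (x y z : {set V}) (t : seq V) (n : nat).

Definition orient f x : F x := f x (enum x) *~ ord_sign (enum x).

Definition to_cochain phi : cochain F := fun x t => phi x *~ ord_sign t.

Definition oriented_by n f phi : Prop :=
  forall x t, ordered_face X n x t -> f x t = phi x *~ ord_sign t.

Definition face_cobd phi y : F y :=
  \sum_(u in y) res F (y :\ u) y (phi (y :\ u)) *~ del_sign u y.

Definition cobd_shift phi psi x : F x := phi x + face_cobd psi x.

Definition supported_above z phi : Prop :=
  forall y, ~~ (z \subset y) -> phi y = 0.

Definition mask (D : pred {set V}) phi x : F x := if D x then phi x else 0.

Lemma ordered_face_enum n x : x \in faces X n -> ordered_face X n x (enum x).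
Proof.
rewrite inE => /andP[xX /eqP <-].
by rewrite /ordered_face xX enum_uniq -cardE eqxx set_enum eqxx.
Qed.

Lemma ordered_faceP n x t : ordered_face X n x t ->
  [/\ x \in faces X n, size t = n, uniq t & [set u in t] = x].
Proof.
case/and4P=> xX /eqP tn ut /eqP tx; split=> //.
by rewrite inE xX -tx cardsE (card_uniqP ut) tn eqxx.
Qed.

Lemma ordered_face_eq0 n f phi x t : oriented_by n f phi ->
  ordered_face X n x t -> (f x t == 0) = (phi x == 0).
Proof.
move=> fphi xt; rewrite (fphi _ _ xt) mulrz_sqr1_eq0 // ord_sign_sqr //.
by case: (ordered_faceP xt).
Qed.

Lemma oriented_by_orient n f : is_cochain n f -> oriented_by n f (orient f).
Proof.
move=> cf x t xt; have [xX tn ut tx] := ordered_faceP xt.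
have enum_n : size (enum x) == n by move: xX; rewrite -cardE inE => /andP[].
have size_n : size t == n by rewrite tn.
have /tuple_permP[s tE] : perm_eq (Tuple size_n) (Tuple enum_n).
  by apply: uniq_perm; rewrite ?enum_uniq // => u; rewrite mem_enum -tx inE.
have := cf x (Tuple enum_n) s (ordered_face_enum xX); rewrite -tE /= => ->.
rewrite -[t in RHS]/(tval (Tuple size_n)) tE ord_sign_perm /orient /= -mulrzA.
by rewrite mulrCA ord_sign_sqr ?enum_uniq // mulr1.
Qed.

Lemma cochain_of_oriented_by n f phi : oriented_by n f phi -> is_cochain n f.
Proof.
move=> fphi x t s xt; have [xX _ ut tx] := ordered_faceP xt.
have perm_t : perm_eq [tuple tnth t (s i) | i < n] t.
  by apply/tuple_permP; exists s.
rewrite !fphi // ?ord_sign_perm 1?mulrC ?mulrzA //.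
move: xX; rewrite inE => /andP[xX _].
rewrite /ordered_face xX size_tuple eqxx (perm_uniq perm_t) ut -tx /=.
by apply/eqP/setP => u; rewrite !inE (perm_mem perm_t).
Qed.

Lemma eq_face_cobd phi psi y :
  (forall u, u \in y -> phi (y :\ u) = psi (y :\ u)) ->
  face_cobd phi y = face_cobd psi y.
Proof. by move=> phi_psi; apply: eq_bigr => u uy; rewrite phi_psi. Qed.

Lemma take_tnth_drop t (i : 'I_(size t)) :
  take i t ++ tnth (in_tuple t) i :: drop i.+1 t = t.
Proof.
by rewrite (tnth_nth (tnth (in_tuple t) i)) -drop_nth // cat_take_drop.
Qed.

Lemma ordered_face_del n y t (i : 'I_(size t)) : ordered_face X n.+1 y t ->
  ordered_face X n (y :\ tnth (in_tuple t) i) (del t i).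
Proof.
move=> yt; have [] := ordered_faceP yt; rewrite inE => /andP[yX _] tn ut ty.
set u := tnth _ i.
have tE : take i t ++ u :: drop i.+1 t = t := take_tnth_drop i.
have : uniq (take i t ++ u :: drop i.+1 t) by rewrite tE.
rewrite uniq_catC cat_cons /= mem_cat negb_or.
case/andP=> /andP[u_drop u_take] ut'.
rewrite /ordered_face (face_sub yX (subsetDl _ _)) uniq_catC ut'.
have -> : size (del t i) == n.
  rewrite size_cat size_takel ?size_drop ?(ltnW (ltn_ord i)) //.
  by apply/eqP; have := ltn_ord i; lia.
have t_mem v : (v \in t) = [|| v \in take i t, v == u | v \in drop i.+1 t].
  by rewrite -[in LHS]tE mem_cat inE.
apply/eqP/setP => v; rewrite -ty !inE t_mem mem_cat.
by case: eqVneq => [->|] //=; rewrite (negPf u_drop) (negPf u_take).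
Qed.

Lemma oriented_by_cobd n f phi : oriented_by n f phi ->
  oriented_by n.+1 (cobd f) (face_cobd phi).
Proof.
move=> fphi y t yt; have [yX tn ut ty] := ordered_faceP yt.
rewrite /face_cobd mulrz_suml (eq_bigl (mem t)) => [|u]; last first.
  by rewrite -ty inE.
rewrite -big_uniq //= big_tnth /cobd; apply: eq_bigr => i _; set u := tnth _ i.
have yt' := ordered_face_del i yt; rewrite (fphi _ _ yt') raddfMz -!mulrzA.
have [_ _ ut' ty'] := ordered_faceP yt'.
have := @ord_sign_del V (take i t) u (drop i.+1 t).
rewrite take_tnth_drop size_takel ?(ltnW (ltn_ord i)) // => /(_ ut) signE.
rewrite mulrC signE mulrC /del_sign -ty' big_uniq //; congr (_ *~ (_ * _)).
by apply: eq_bigl => v; rewrite inE.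
Qed.

Lemma face_cobd_neq0 phi y : face_cobd phi y != 0 ->
  exists2 u, u \in y & phi (y :\ u) != 0.
Proof.
move=> cobd_neq0; apply/exists_inP; apply: contraNT cobd_neq0.
rewrite negb_exists_in => /forall_inP phi0; apply/eqP; apply: big1 => u uy.
by have := phi0 u uy; rewrite negbK => /eqP ->; rewrite raddf0 mul0rz.
Qed.

Lemma supported_above_cobd z phi :
  supported_above z phi -> supported_above z (face_cobd phi).
Proof.
move=> supp y zy; apply/eqP; apply: contraNT zy => /face_cobd_neq0[u _].
apply: contraR => zy; rewrite supp //.
by apply: contra zy => /subset_trans; apply; exact: subsetDl.
Qed.

Lemma supported_above_shift z phi psi : supported_above z phi ->
  supported_above z psi -> supported_above z (cobd_shift phi psi).
Proof.
move=> supp_phi supp_psi y zy; rewrite /cobd_shift supp_phi //.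
by rewrite (supported_above_cobd supp_psi) ?addr0.
Qed.

Lemma supported_above_mask z (D : pred {set V}) phi :
  (forall y, D y -> z \subset y) -> supported_above z (mask D phi).
Proof. by move=> Dz y zy; rewrite /mask ifN //; apply: contra zy => /Dz. Qed.

Lemma faces_setD1 n y u : y \in faces X n.+1 -> u \in y -> y :\ u \in faces X n.
Proof.
rewrite !inE => /andP[yX yn] uy; rewrite (face_sub yX (subsetDl _ _)) /=.
by rewrite (cardsD1 u) uy add1n eqSS in yn.
Qed.

Lemma oriented_by_shift n f g phi psi :
  oriented_by n.+1 f phi -> oriented_by n g psi ->
  oriented_by n.+1 (addc f (cobd g)) (cobd_shift phi psi).
Proof.
move=> fphi gpsi x t xt; rewrite /addc /cobd_shift fphi //.
by rewrite (oriented_by_cobd gpsi) // mulrzDl.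
Qed.

Variables (R : realType) (d : nat).

Definition support_weight n phi : R :=
  total_weight R d X n (fun x => phi x != 0).

Lemma support_weight_ge0 n phi : 0 <= support_weight n phi.
Proof. exact: total_weight_ge0. Qed.

Lemma support_weight_indicator n phi :
  support_weight n phi = \sum_(x in faces X n) (phi x != 0)%:R * weight R d X x.
Proof. exact: total_weight_indicator. Qed.

Lemma eq_support_weight n phi psi : {in faces X n, forall x, phi x = psi x} ->
  support_weight n phi = support_weight n psi.
Proof. by move=> phi_psi; apply: eq_total_weight => x /phi_psi ->. Qed.

Lemma norm_oriented_by n f phi : oriented_by n f phi ->
  norm R d n f = support_weight n phi.
Proof.
move=> fphi; apply: eq_bigl => x; apply: andb_id2l => xX.
by rewrite (ordered_face_eq0 fphi) // ordered_face_enum.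
Qed.

End OrientedFamilies.
Arguments support_weight {V X F} R d n phi.

Section LinkFamilies.
Variables (V : finType) (X : {set {set V}}) (F : aug_sheaf X).
Implicit Types (phi psi : forall x, F x) (x y z : {set V}) (s t : seq V).

Definition link_family z phi (x : {set V}) : link_sheaf F z x :=
  phi (x :|: z) *~ cross_sign x z.

Lemma link_family_cat n m x z s t phi : ordered_face X m z t ->
  ordered_face (link X z) n x s ->
  phi (x :|: z) *~ ord_sign (s ++ t) =
  link_family z phi x *~ ord_sign t *~ ord_sign s.
Proof.
move=> /ordered_faceP[_ _ ut <-] /ordered_faceP[_ _ us <-].
rewrite ord_sign_cat cross_signE // /link_family -!mulrzA.
by congr (_ *~ _); ring.
Qed.

Lemma family_congr (A : Type) (h : forall x, F x -> A) phi x y :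
  x = y -> h x (phi x) = h y (phi y).
Proof. by move=> ->. Qed.

Lemma face_cobd_link z phi x : supported_above z phi -> x :&: z = set0 ->
  face_cobd (link_family z phi) x = link_family z (face_cobd phi) x.
Proof.
move=> supp xz; rewrite /face_cobd /link_family mulrz_suml /=.
rewrite [RHS](bigID (mem z)) /= [X in X + _]big1 ?add0r => [|u /andP[_ uz]];
  last first.
  rewrite supp ?raddf0 ?mul0rz //.
  by apply/negP => /subsetP/(_ u uz); rewrite !inE eqxx.
have x_notin_z u : u \in x -> u \notin z.
  by move=> ux; apply/negP => uz; have := in_set0 u; rewrite -xz inE ux uz.
apply: eq_big => [u|u ux].
  rewrite inE; have [/x_notin_z ->|] := boolP (u \in x) => //=.
  by rewrite andbN.
have uz := x_notin_z u ux.
have xuz : (x :\ u) :|: z = (x :|: z) :\ u.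
  rewrite [RHS]setDUl; congr (_ :|: _); apply/esym/setDidPl.
  by rewrite disjoint_sym disjoints1.
rewrite raddfMz (family_congr (fun y => res F y (x :|: z)) phi xuz) -!mulrzA.
congr (_ *~ _); rewrite del_signU // [in RHS](cross_signD1 z ux).
set p := \prod_(v in z) _; have pp : p * p = 1.
  apply: prod_sqr_eq1 => v vz; apply: pair_sign_sqr.
  by apply: contraNneq uz => ->.
transitivity (cross_sign (x :\ u) z * del_sign u x * (p * p)); last by ring.
by rewrite pp mulr1.
Qed.

Lemma link_family_surj z (chi : forall x, link_sheaf F z x) :
  exists2 phi, supported_above z phi &
    forall x, x :&: z = set0 -> link_family z phi x = chi x.
Proof.
pose lift x : F (x :|: z) := chi x *~ cross_sign x z.
pose phi y : F y := if (y :\: z) :|: z =P y is ReflectT yE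
  then eq_rect _ (fun y => F y) (lift (y :\: z)) y yE else 0.
exists phi => [y zy|x xz].
  by rewrite /phi; case: eqP => // yE; case/negP: zy; rewrite -yE subsetUr.
have phiE : phi (x :|: z) = lift x.
  rewrite /phi; case: eqP => [|[]]; rewrite setUDK_disjoint // => xE.
  by rewrite (eq_axiomK xE).
by rewrite /link_family phiE -mulrzA cross_sign_sqr.
Qed.

Lemma link_family_eq0 z phi x : x \in link X z ->
  (link_family z phi x == 0) = (phi (x :|: z) == 0).
Proof. by move=> /link_disjoint/cross_sign_sqr; exact: mulrz_sqr1_eq0. Qed.

Lemma link_family_shift z phi psi x : supported_above z psi -> x :&: z = set0 ->
  link_family z (cobd_shift phi psi) x =
  cobd_shift (link_family z phi) (link_family z psi) x.
Proof.
by move=> supp xz; rewrite /cobd_shift face_cobd_link // /link_family mulrzDl.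
Qed.

Variables (R : realType) (d : nat) (z : {set V}).
Hypothesis hX : is_dcomplex d X.
Hypotheses (zX : z \in X) (zd : (#|z| <= d)%N).

Lemma support_weight_link n phi : supported_above z phi ->
  support_weight R (d - #|z|) n (link_family z phi) =
  n`!%:R / ((n + #|z|)`!%:R * flag_weight R d X z) *
    support_weight R d (n + #|z|) phi.
Proof.
move=> supp; rewrite [LHS](total_weight_link R hX zX zd); congr (_ * _).
apply: eq_total_weight => y; rewrite inE => /andP[yX _].
have [zy|/supp ->] := boolP (z \subset y); last by rewrite eqxx.
rewrite link_family_eq0 ?link_setD //; congr (~~ _).
by apply: (family_congr (fun y a => a == 0)); rewrite setDKU.
Qed.

Lemma support_weight_link_le (c : R) n phi psi : (#|z| <= n)%N ->
  supported_above z phi -> supported_above z psi ->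
  (c * support_weight R (d - #|z|) (n - #|z|) (link_family z phi)
     <= support_weight R (d - #|z|) (n - #|z|).+1 (link_family z psi)) =
  (c * n.+1%:R * support_weight R d n phi
     <= (n.+1 - #|z|)%:R * support_weight R d n.+1 psi).
Proof.
move=> zn supp_phi supp_psi.
rewrite !support_weight_link // addSn subnK // subSn //.
rewrite !factS !natrM; move: (n - #|z|)%N => j.
have fwz_gt0 : 0 < flag_weight R d X z by exact: flag_weight_gt0.
move: (fact_gt0 n) (fact_gt0 j) (ltr0Sn R n) fwz_gt0; rewrite -!(ltr0n R).
move: (n`!%:R) (j`!%:R) (n.+1%:R) (j.+1%:R) (flag_weight R d X z).
move=> p q a b w p_gt0 q_gt0 a_gt0 w_gt0.
move: (support_weight _ _ n _) (support_weight _ _ n.+1 _) => A B.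
have scale_gt0 : 0 < q / (a * p * w) by rewrite divr_gt0 ?mulr_gt0.
rewrite (_ : c * (_ * A) = q / (a * p * w) * (c * a * A)); last first.
  by field; rewrite !gt_eqF.
by rewrite (_ : b * q / _ * B = q / (a * p * w) * (b * B)) ?ler_pM2l //; ring.
Qed.

End LinkFamilies.

Section LocalMinimality.
Variables (R : realType) (V : finType) (X : {set {set V}}) (F : aug_sheaf X).
Variable d : nat.
Hypothesis hX : is_dcomplex d X.
Implicit Types (phi psi : forall x, F x) (x y z : {set V}) (n : nat).

Local Notation face_sub := (face_subset hX).

Definition minimal_family n phi : Prop := forall z psi,
  z \in X -> z != set0 -> supported_above z psi ->
  support_weight R d n phi <= support_weight R d n (cobd_shift phi psi).

Lemma to_cochain_extension m n z psi :
  z \in faces X n -> supported_above z psi ->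
  is_extension (m + n) (enum z)
    (fun x t => to_cochain psi (x :|: z) (t ++ enum z)) (to_cochain psi).
Proof.
move=> zX supp; split=> [|//|y t _ zy]; last first.
  by rewrite /to_cochain supp ?mul0rz.
exact: (@cochain_of_oriented_by _ _ _ _ _ psi).
Qed.

Lemma to_cochain_link_cochain m n z psi : z \in faces X n ->
  is_cochain m
    ((fun x t => to_cochain psi (x :|: z) (t ++ enum z))
       : cochain (link_sheaf F z)).
Proof.
move=> zX; apply: (@cochain_of_oriented_by _ _ (link_sheaf F z) _ _
  (fun x => link_family z psi x *~ ord_sign (enum z))) => x t xt.
exact: link_family_cat (ordered_face_enum zX) xt.
Qed.

Lemma minimal_family_of_cochain n f phi : is_cochain n.+1 f ->
  oriented_by n.+1 f phi -> locally_minimal R d n.+1 f ->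
  minimal_family n.+1 phi.
Proof.
move=> cf fphi minf z psi zX z_neq0 supp.
have [zn|zn] := leqP #|z| n; last first.
  rewrite (eq_support_weight _ _ (psi := cobd_shift phi psi)) // => y yX.
  rewrite /cobd_shift [face_cobd psi y]big1 ?addr0 // => u uy.
  rewrite supp ?raddf0 ?mul0rz //.
  have := faces_setD1 face_sub yX uy; rewrite inE => /andP[_ /eqP yun].
  by apply: contraL zn => /subset_leq_card; rewrite yun -leqNgt.
have zface : z \in faces X #|z| by rewrite inE zX eqxx.
have z_card : (0 < #|z| < n.+1)%N by rewrite ltnS zn andbT card_gt0.
have := to_cochain_extension (n - #|z|) zface supp; rewrite subnK // => ext.
have gcochain := @to_cochain_link_cochain (n.+1.-1 - #|z|) _ _ psi zface.
have := minf _ _ _ z_card (ordered_face_enum zface) _ gcochain _ ext.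
have psi_oriented : oriented_by n (to_cochain psi) psi by [].
have shift_oriented := oriented_by_shift face_sub fphi psi_oriented.
by rewrite (norm_oriented_by R d fphi) (norm_oriented_by R d shift_oriented).
Qed.

(* The discarded part of the support costs at most its own weight on both
   sides. *)
Lemma minimal_family_mask n phi z (D : pred {set V}) psi :
  minimal_family n phi ->
  z \in X -> z != set0 -> supported_above z psi ->
  support_weight R d n (mask D phi)
    <= support_weight R d n (cobd_shift (mask D phi) psi).
Proof.
move=> minphi zX z_neq0 supp; have := minphi z psi zX z_neq0 supp.
rewrite !support_weight_indicator -subr_ge0 -sumrB => diff_ge0.
rewrite -subr_ge0 -sumrB; apply: le_trans diff_ge0 _.
apply: ler_sum => y _; rewrite -!mulrBl ler_wpM2r ?weight_ge0 //.
rewrite /cobd_shift /mask; case: ifP => Dy //.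
rewrite add0r eqxx subr0 lerBlDr -natrD ler_nat.
have [->|phi_neq0] := eqVneq (phi y) 0; first by rewrite add0r addn0.
by rewrite addn1 (leq_trans (leq_b1 _)).
Qed.

End LocalMinimality.

Section FamilyExpansion.
Variables (R : realType) (V : finType) (X : {set {set V}}) (F : aug_sheaf X).
Variable d : nat.
Hypothesis hX : is_dcomplex d X.

Lemma mass_le1 n : (n <= d.+1)%N -> mass R F d n <= 1.
Proof. exact: total_weight_le1. Qed.

Lemma mass_eq1 n : (n <= d.+1)%N ->
  (forall x, x \in faces X n -> nontrivial (F x)) -> mass R F d n = 1.
Proof.
move=> nd ntriv; rewrite -(total_weight_predT R hX nd).
by apply: eq_total_weight => x /ntriv/asboolT.
Qed.

Lemma cobd_expander_family n (eps : R) : cobd_expander F d n eps ->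
  forall phi : (forall x, F x), exists psi : forall x, F x,
    eps * support_weight R d n (cobd_shift phi psi) * mass R F d n.+1
    <= support_weight R d n.+1 (face_cobd phi) * mass R F d n.
Proof.
move=> expF phi; have face_sub := face_subset hX.
have phi_oriented m : oriented_by m (to_cochain phi) phi by [].
have [b [cb _]] := expF _ (cochain_of_oriented_by (phi_oriented n)).
rewrite (norm_oriented_by R d (oriented_by_cobd face_sub (phi_oriented n))).
have [psi bpsi] : exists psi, oriented_by n b (face_cobd psi).
  case: n cb {expF} => [b0|m [g cg bE]].
    exists (fun _ => 0) => x t xt; rewrite b0 // [face_cobd _ _]big1 ?mul0rz //.
    by move=> u _; rewrite raddf0 mul0rz.
  exists (orient g) => x t xt; rewrite bE //.
  exact: (oriented_by_cobd face_sub (oriented_by_orient cg)).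
rewrite (norm_oriented_by R d (phi := cobd_shift phi psi)) => [expand|x t xt].
  by exists psi.
by rewrite /addc bpsi // -mulrzDl.
Qed.

Lemma cobd_expander_nontrivial n (eps : R) : (n <= d)%N ->
  (forall x, x \in faces X n.+1 -> nontrivial (F x)) ->
  cobd_expander F d n eps ->
  forall phi : (forall x, F x), exists psi : forall x, F x,
    eps * support_weight R d n (cobd_shift phi psi)
    <= support_weight R d n.+1 (face_cobd phi).
Proof.
move=> nd ntriv /cobd_expander_family expF phi; have [psi expand] := expF phi.
exists psi; move: expand; rewrite mass_eq1 // mulr1 => /le_trans; apply.
by rewrite ler_piMr ?support_weight_ge0 ?mass_le1 ?leqW.
Qed.

End FamilyExpansion.

Section LocalExpansion.
Variables (R : realType) (V : finType) (X : {set {set V}}) (F : aug_sheaf X).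
Variable d : nat.
Hypothesis hX : is_dcomplex d X.
Variables (n : nat) (z : {set V}) (eps : R).
Hypotheses (zX : z \in X) (zn : (#|z| <= n)%N) (nd : (n <= d)%N).
Hypothesis ntriv : forall x, x \in faces X n.+1 -> nontrivial (F x).
Hypothesis expz : cobd_expander (link_sheaf F z) (d - #|z|) (n - #|z|) eps.
Implicit Types (phi psi : forall x, F x).

Lemma link_expansion phi : supported_above z phi ->
  exists2 psi, supported_above z psi &
    eps * n.+1%:R * support_weight R d n (cobd_shift phi psi)
    <= (n.+1 - #|z|)%:R * support_weight R d n.+1 (face_cobd phi).
Proof.
move=> supp; have zd := leq_trans zn nd; have link_dc := link_dcomplex hX zX zd.
have ntrivz x :
    x \in faces (link X z) (n - #|z|).+1 -> nontrivial (link_sheaf F z x).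
  rewrite inE in_link => /andP[/andP[/eqP xz xX] /eqP xj]; apply: ntriv.
  by rewrite inE xX cardsU_disjoint // xj addSn subnK /=.
have nzd : (n - #|z| <= d - #|z|)%N by rewrite leq_sub2r.
have [chi] :=
  cobd_expander_nontrivial link_dc nzd ntrivz expz (link_family z phi).
have [psi supp_psi psiE] := link_family_surj chi; exists psi => //.
have shiftE x : x \in faces (link X z) (n - #|z|) ->
    link_family z (cobd_shift phi psi) x =
    cobd_shift (link_family z phi) chi x.
  rewrite inE => /andP[/link_disjoint xz _]; rewrite link_family_shift //.
  congr (_ + _); apply: eq_face_cobd => u _.
  by rewrite psiE // setIDAC xz set0D.
have cobdE x : x \in faces (link X z) (n - #|z|).+1 ->
    link_family z (face_cobd phi) x = face_cobd (link_family z phi) x.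
  by rewrite inE => /andP[/link_disjoint xz _]; rewrite face_cobd_link.
rewrite -(support_weight_link_le hX zX zd) //.
- by rewrite (eq_support_weight _ _ shiftE) (eq_support_weight _ _ cobdE).
- exact: supported_above_shift.
exact: supported_above_cobd.
Qed.

Lemma local_expansion phi (D : pred {set V}) :
  minimal_family R d n phi -> z != set0 -> 0 <= eps ->
  (forall y, D y -> z \subset y) ->
  eps * n.+1%:R * support_weight R d n (mask D phi)
  <= (n.+1 - #|z|)%:R * support_weight R d n.+1 (face_cobd (mask D phi)).
Proof.
move=> minphi z_neq0 eps_ge0 Dz.
have [psi supp_psi] := link_expansion (supported_above_mask phi Dz).
apply: le_trans; apply: ler_wpM2l; first by rewrite mulr_ge0.
exact: (minimal_family_mask _ minphi zX).
Qed.

End LocalExpansion.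

Section Descent.
Variables (V : finType) (T : {set {set V}}).
Implicit Types (x y z u : {set V}) (v : V).

Definition descent : rel {set V} := fun x x' =>
  [&& x \in T, x' \in T & [exists v in x, x' == x :\ v]].

Definition terminal z := (z \in T) && [forall v in z, z :\ v \notin T].

Definition diamond y : Prop := forall x v v', x \subset y ->
  v \in x -> v' \in x -> v != v' -> x :\ v \in T -> x :\ v' \in T ->
  x :\ v :\ v' \in T.

Definition defect_weight (R : realType) d (X : {set {set V}}) n : R :=
  total_weight R d X n (fun y => `[< ~ diamond y >]).

Lemma descentP x x' : reflect
  [/\ x \in T, x' \in T & exists2 v, v \in x & x' = x :\ v] (descent x x').
Proof.
apply: (iffP and3P) =>
  [[xT x'T /exists_inP[v vx /eqP x'E]]|[xT x'T [v vx x'E]]].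
  by split=> //; exists v.
by split=> //; apply/exists_inP; exists v => //; apply/eqP.
Qed.

Lemma connect_descent_subset x z : connect descent x z -> z \subset x.
Proof.
case/connectP=> p; elim: p x => [|x' p IH] x /=; first by move=> _ ->.
case/andP=> /descentP[_ _ [v _ x'E]] /IH{}IH /IH.
by rewrite x'E => /subset_trans; apply; exact: subsetDl.
Qed.

Lemma connect_descent1 x v : x \in T -> v \in x -> x :\ v \in T ->
  connect descent x (x :\ v).
Proof. by move=> xT vx xvT; apply/connect1/descentP; split=> //; exists v. Qed.

Lemma connect_descent_head x z : connect descent x z ->
  x = z \/ exists v, [/\ v \in x, x :\ v \in T & connect descent (x :\ v) z].
Proof.
case/connectP=> [[|x' p]] /=; first by move=> _ ->; left.
case/andP=> /descentP[_ x'T [v vx x'E]] px' zE; right.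
by exists v; rewrite -x'E; split=> //; apply/connectP; exists p.
Qed.

Lemma terminal_exists x :
  x \in T -> exists2 z, terminal z & connect descent x z.
Proof.
have [n] := ubnP #|x|; elim: n x => // n IH x xn xT.
have [tx|] := boolP (terminal x); first by exists x.
rewrite /terminal xT negb_forall_in => /exists_inP[v vx]; rewrite negbK => xvT.
have [|z tz xvz] := IH (x :\ v) _ xvT; first by rewrite (cardsD1 v) vx in xn.
by exists z => //; apply: connect_trans xvz; exact: connect_descent1.
Qed.

Lemma terminal_connect z z' : terminal z -> connect descent z z' -> z' = z.
Proof.
case/andP=> _ /forall_inP tz /connect_descent_head[//|[v [vz zvT _]]].
by have := tz v vz; rewrite zvT.
Qed.

Lemma diamond_join y x v v' : diamond y -> x \subset y ->
  v \in x -> v' \in x -> x :\ v \in T -> x :\ v' \in T ->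
  exists z, [/\ terminal z, connect descent (x :\ v) z
               & connect descent (x :\ v') z].
Proof.
move=> dy xy vx v'x xvT xv'T; have [vv'|vv'] := eqVneq v v'.
  by have [z tz xz] := terminal_exists xvT; exists z; rewrite -vv'.
have xvv'T : x :\ v :\ v' \in T by exact: (dy x v v').
have [z tz xz] := terminal_exists xvv'T; exists z; split=> //.
  apply: connect_trans xz; apply: connect_descent1 => //.
  by rewrite !inE eq_sym vv'.
apply: connect_trans xz; rewrite setDDl setUC -setDDl.
by apply: connect_descent1; rewrite ?inE ?vv' // setDDl setUC -setDDl.
Qed.

(* Newman's lemma. *)
Lemma terminal_unique y x z z' : diamond y -> x \subset y ->
  terminal z -> terminal z' ->
  connect descent x z -> connect descent x z' -> z = z'.
Proof.
move=> dy; have [n] := ubnP #|x|.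
elim: n x z z' => // n IH x z z' xn xy tz tz' xz xz'.
have [xE|[v [vx xvT vz]]] := connect_descent_head xz.
  by rewrite xE in xz'; rewrite (terminal_connect tz xz').
have [xE|[v' [v'x xv'T v'z']]] := connect_descent_head xz'.
  by rewrite xE in xz; rewrite (terminal_connect tz' xz).
have [t [tt vt v't]] := diamond_join dy xy vx v'x xvT xv'T.
have sub a : x :\ a \subset y by apply: subset_trans (subsetDl _ _) xy.
have lt_n a : a \in x -> (#|x :\ a| < n)%N.
  by move=> ax; rewrite (cardsD1 a) ax in xn.
rewrite (IH _ _ _ (lt_n v vx) (sub v) tz tt vz vt).
by rewrite (IH _ _ _ (lt_n v' v'x) (sub v') tz' tt).
Qed.

Lemma terminal_setD1 y a b z : diamond y -> a \in y -> b \in y ->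
  y :\ a \in T -> y :\ b \in T -> terminal z ->
  connect descent (y :\ a) z -> connect descent (y :\ b) z.
Proof.
move=> dy ya yb yaT ybT tz yaz.
have [t [tt yat ybt]] := diamond_join dy (subxx y) ya yb yaT ybT.
by rewrite (terminal_unique dy (subsetDl _ _) tz tt yaz yat).
Qed.

End Descent.

Section Pieces.
Variables (V : finType) (X : {set {set V}}) (F : aug_sheaf X).
Variables (n : nat) (T : {set {set V}}) (phi : forall x, F x).
Hypothesis face_sub : forall x y : {set V}, y \in X -> x \subset y -> x \in X.
Hypothesis suppT : forall x, x \in faces X n -> (x \in T) = (phi x != 0).
Implicit Types (x y z : {set V}) (u : V).

Definition piece z : forall x, F x :=
  mask [pred x | connect (descent T) x z] phi.

Lemma piece_neq0 z y u : y \in faces X n.+1 -> u \in y ->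
  piece z (y :\ u) != 0 -> y :\ u \in T /\ connect (descent T) (y :\ u) z.
Proof.
move=> yX uy; rewrite /piece /mask /=; case: ifP => [uz phi_neq0|]; last first.
  by rewrite eqxx.
by rewrite suppT // faces_setD1.
Qed.

Lemma face_cobd_piece y z : y \in faces X n.+1 -> diamond T y -> terminal T z ->
  face_cobd (piece z) y != 0 -> face_cobd phi y != 0.
Proof.
move=> yX dy tz cobd_neq0.
have [u uy /(piece_neq0 yX uy)[uT uz]] := face_cobd_neq0 cobd_neq0.
rewrite (_ : face_cobd phi y = face_cobd (piece z) y) //.
apply: eq_face_cobd => a ay; rewrite /piece /mask /=; case: ifPn => // az.
apply/eqP; apply: contraNT az => phi_neq0; apply: (terminal_setD1 dy uy) => //.
by rewrite suppT ?faces_setD1.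
Qed.

Lemma face_cobd_piece_inj y z z' : y \in faces X n.+1 -> diamond T y ->
  terminal T z -> terminal T z' ->
  face_cobd (piece z) y != 0 -> face_cobd (piece z') y != 0 -> z = z'.
Proof.
move=> yX dy tz tz' /face_cobd_neq0[u uy /(piece_neq0 yX uy)[uT uz]].
move=> /face_cobd_neq0[u' u'y /(piece_neq0 yX u'y)[u'T u'z']].
apply: (terminal_unique dy (subsetDl _ _) tz tz' _ u'z').
exact: (terminal_setD1 dy uy).
Qed.

Definition active_pieces y :=
  [set z | terminal T z & face_cobd (piece z) y != 0].

Lemma card_active_pieces_diamond y : y \in faces X n.+1 -> diamond T y ->
  (#|active_pieces y| <= (face_cobd phi y != 0%R))%N.
Proof.
move=> yX dy; have [->|[z]] := set_0Vmem (active_pieces y).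
  by rewrite cards0.
rewrite inE => /andP[tz z_act]; rewrite (face_cobd_piece yX dy tz z_act).
apply/card_le1P => z'; rewrite inE => /andP[tz' z'_act] z''.
rewrite !inE; apply/andP/eqP => [[tz'' z''_act]|-> //].
exact: (face_cobd_piece_inj yX dy).
Qed.

Lemma card_active_pieces y :
  y \in faces X n.+1 -> (#|active_pieces y| <= 2 ^ n.+1)%N.
Proof.
move=> yX; have := yX; rewrite inE => /andP[_ /eqP <-]; rewrite -card_powerset.
apply/subset_leq_card/subsetP => z.
rewrite !inE => /andP[_ /face_cobd_neq0[u uy]].
case/(piece_neq0 yX uy) => _ /connect_descent_subset/subset_trans; apply.
exact: subsetDl.
Qed.

Lemma sum_piece_weight (R : realType) d :
  \sum_(z | terminal T z) support_weight R d n.+1 (face_cobd (piece z))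
  <= support_weight R d n.+1 (face_cobd phi)
     + 2 ^+ n.+1 * defect_weight T R d X n.+1.
Proof.
under eq_bigr do rewrite support_weight_indicator.
rewrite exchange_big support_weight_indicator /defect_weight.
rewrite total_weight_indicator mulr_sumr -big_split; apply: ler_sum => y yX /=.
rewrite -mulr_suml mulrA -mulrDl ler_wpM2r ?weight_ge0 //.
rewrite -natr_sum -natrX -natrM -natrD ler_nat.
have -> : (\sum_(z | terminal T z) (face_cobd (piece z) y != 0%R)
    = #|active_pieces y|)%N.
  rewrite -sum1_card big_mkcond [RHS]big_mkcond; apply: eq_bigr => z _.
  by rewrite inE; case: (terminal T z); case: (face_cobd _ _ != 0).
have [dy|ndy] := pselect (diamond T y).
  exact: leq_trans (card_active_pieces_diamond yX dy) (leq_addr _ _).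
by rewrite (asboolT ndy) muln1 (leq_trans (card_active_pieces yX)) ?leq_addl.
Qed.

Lemma support_weight_le_pieces (R : realType) d :
  support_weight R d n phi <=
  \sum_(z | terminal T z) support_weight R d n (piece z).
Proof.
under [X in _ <= X]eq_bigr do rewrite support_weight_indicator.
rewrite exchange_big support_weight_indicator; apply: ler_sum => x xX /=.
have w_ge0 (b : bool) : 0 <= b%:R * weight R d X x.
  by rewrite mulr_ge0 ?weight_ge0.
have [phi0|phi_neq0] := eqVneq (phi x) 0; first by rewrite mul0r sumr_ge0.
have [z tz xz] : exists2 z, terminal T z & connect (descent T) x z.
  by apply: terminal_exists; rewrite suppT.
by rewrite (bigD1 z) //= {1}/piece /mask /= xz phi_neq0 lerDl sumr_ge0.
Qed.

Lemma pieces_expand (R : realType) d (eps : R) : 0 <= eps ->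
  (forall z, terminal T z ->
     eps * support_weight R d n (piece z) <=
     support_weight R d n.+1 (face_cobd (piece z))) ->
  eps * support_weight R d n phi <=
  support_weight R d n.+1 (face_cobd phi)
  + 2 ^+ n.+1 * defect_weight T R d X n.+1.
Proof.
move=> eps_ge0 expand; apply: le_trans (sum_piece_weight R d).
apply: le_trans (ler_wpM2l eps_ge0 (support_weight_le_pieces R d)) _.
by rewrite mulr_sumr; exact: ler_sum.
Qed.

End Pieces.

Section Conflicts.
Variables (V : finType) (T : {set {set V}}).
Implicit Types (y u : {set V}) (v : V) (p : {set V} * (V * V)).

(* [(u, (v, v'))] is a conflict if [u] is the missing face of a diamond. *)
Definition conflict p : bool := let: (u, (v, v')) := p in
  [&& u \notin T, v \notin u, v' \notin u, v != v', v |: u \in T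
    & v' |: u \in T].

Definition apex p : {set V} := let: (u, (v, v')) := p in v |: (v' |: u).

Lemma card_apex p : conflict p -> #|apex p| = #|p.1|.+2.
Proof.
case: p => u [v v'] /and5P[_ vu v'u vv' _].
by rewrite /= !cardsU1 !inE negb_or vu v'u vv'.
Qed.

Lemma conflict_of_not_diamond y : ~ diamond T y ->
  exists2 p, conflict p & apex p \subset y.
Proof.
move=> ndy; apply: contrapT => no_conflict.
apply: ndy => x v v' xy vx v'x vv' xvT xv'T.
apply: contrapT => /negP uT; apply: no_conflict; exists (x :\ v :\ v', (v, v')).
  have -> : conflict (x :\ v :\ v', (v, v')) = (v |: (x :\ v :\ v') \in T).
    rewrite /= uT !inE !eqxx !andbF vv' setD1K ?xvT ?andbT //.
    by rewrite !inE eq_sym vv'.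
  by rewrite setDDl [_ :|: [set v']]setUC -setDDl setD1K // !inE vv'.
by rewrite /= setD1K ?setD1K // !inE eq_sym vv'.
Qed.

End Conflicts.

Section FatFaces.
Variables (R : realType) (V : finType) (X : {set {set V}}) (d k : nat).
Hypothesis hX : is_dcomplex d X.
Implicit Types (x y z u : {set V}) (v : V) (T : {set {set V}}).

Local Notation fw := (flag_weight R d X).
Local Notation vw := (@vertex_weight R V d X).
Local Notation lg := (@link_graph R V d X).

Definition up_weight T u : R := \sum_v vw u v * (v |: u \in T)%:R.

Definition level_weight T j : R := total_weight R d X j (fun x => x \in T).

Definition fat_family (theta : nat -> R) T : Prop :=
  {subset T <= [set z in X | (#|z| <= k.+1)%N]} /\
  forall z, z \in X -> (#|z| <= k)%N ->
    (z \in T) = (theta #|z| * fw z <= up_weight T z).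

Lemma fat_family_exists (theta : nat -> R) (A : {set {set V}}) :
  A \subset faces X k.+1 ->
  exists2 T, fat_family theta T & {in faces X k.+1, T =i A}.
Proof.
move=> AX; pose next (T : {set {set V}}) j :=
  [set z in faces X j | theta #|z| * fw z <= up_weight T z].
pose layer := fix layer i :=
  if i is i'.+1 then next (layer i') (k - i')%N else A.
have layerX i z : (i <= k.+1)%N -> z \in layer i -> z \in faces X (k.+1 - i)%N.
  case: i => [_|i ik]; first by rewrite subn0; move/(subsetP AX).
  by rewrite subSS inE => /andP[].
pose T := [set z : {set V} | (#|z| <= k.+1)%N && (z \in layer (k.+1 - #|z|)%N)].
exists T; last first.
  by move=> z; rewrite !inE => /andP[_ /eqP ->]; rewrite leqnn subnn.
split=> [z|z zX zk].
  rewrite !inE => /andP[zk /layerX]; rewrite leq_subr inE zk.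
  by move/(_ isT) => /andP[->].
rewrite inE leqW // subSn //= !inE zX subKn // eqxx /=.
congr (_ <= _); apply: eq_bigr => v _; rewrite /vertex_weight.
case: ifP => vz; last by rewrite !mul0r.
by rewrite inE cardsU1 vz add1n ltnS zk subSS.
Qed.

Lemma up_weight_ge0 T u : 0 <= up_weight T u.
Proof. by apply: sumr_ge0 => v _; rewrite mulr_ge0 // vertex_weight_ge0. Qed.

Lemma level_weightE T j : T \subset X ->
  level_weight T j = j`!%:R * \sum_(x in T | #|x| == j) fw x.
Proof.
move/subsetP => TX; rewrite mulr_sumr; apply: eq_big => [x|x].
  by rewrite inE; have [/TX ->|] := boolP (x \in T); rewrite ?andbT ?andbF.
by rewrite inE => /andP[/andP[_ /eqP <-] _]; exact: weightE.
Qed.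

Lemma sum_up_weight T j : T \subset X ->
  \sum_(u : {set V} | #|u| == j) up_weight T u = level_weight T j.+1 / j`!%:R.
Proof.
move=> TX; transitivity (\sum_(u : {set V}) \sum_(v | v \notin u)
    (if (#|u| == j) && (v |: u \in T) then fw (v |: u) else 0)).
  rewrite big_mkcond; apply: eq_bigr => u _; rewrite [RHS]big_mkcond.
  case: eqP => _ /=; last by rewrite big1 // => v _; rewrite if_same.
  apply: eq_bigr => v _; rewrite /vertex_weight; case: ifP => _; last first.
    by rewrite mul0r.
  by case: (_ \in T); rewrite ?mulr1 ?mulr0.
rewrite (sum_setU1 (fun u v =>
  if (#|u| == j) && (v |: u \in T) then fw (v |: u) else 0)).
rewrite level_weightE // factS natrM mulrAC mulfK ?fact_neq0 // mulr_sumr.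
rewrite [RHS]big_mkcond; apply: eq_bigr => x _.
transitivity (\sum_(v in x) (if (x \in T) && (#|x| == j.+1) then fw x else 0)).
  apply: eq_bigr => v vx; rewrite setD1K //.
  by rewrite [in RHS](cardsD1 v) vx add1n eqSS andbC.
rewrite sumr_const; case: (x \in T) => /=; last by rewrite mul0rn.
by case: eqP => [->|_]; rewrite ?mulr_natl ?mul0rn.
Qed.

Section Counting.
Variables (theta : nat -> R) (T : {set {set V}}).
Hypothesis fatT : fat_family theta T.

Lemma fat_subset_complex : T \subset X.
Proof. by apply/subsetP => z /(fatT.1); rewrite inE => /andP[]. Qed.

Lemma card_fat_le z : z \in T -> (#|z| <= k.+1)%N.
Proof. by move/(fatT.1); rewrite inE => /andP[]. Qed.

Lemma level_weight_step j : (j <= k)%N ->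
  theta j * level_weight T j <= level_weight T j.+1.
Proof.
move=> jk; have TX := fat_subset_complex.
have jfact_gt0 : 0 < j`!%:R :> R by rewrite ltr0n fact_gt0.
rewrite -[X in _ <= X](divfK (fact_neq0 R j)).
rewrite -sum_up_weight // level_weightE //.
rewrite mulrCA mulrC ler_pM2r // mulr_sumr big_mkcond [X in _ <= X]big_mkcond.
apply: ler_sum => z _; have [zT|_] /= := boolP (z \in T); case: eqP => // zj.
  by have := zT; rewrite fatT.2 ?zj //; exact: (subsetP TX).
exact: up_weight_ge0.
Qed.

Hypothesis kd : (k < d)%N.

Lemma defect_weight_le_conflicts :
  defect_weight T R d X k.+2 <=
  \sum_(p | conflict T p) (k.+2)`!%:R / (k - #|p.1|)`!%:R * fw (apex p).
Proof.
have card_conflict p : conflict T p -> (#|p.1| <= k)%N.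
  case: p => u [v v'] /and5P[_ vu _ _ /andP[/card_fat_le + _]].
  by rewrite cardsU1 vu add1n ltnS.
apply: (@le_trans _ _ (\sum_(p | conflict T p)
    \sum_(y in faces X k.+2 | apex p \subset y) weight R d X y)).
  rewrite (exchange_big_dep (mem (faces X k.+2))) /=; last first.
    by move=> p y _ /andP[].
  rewrite /defect_weight total_weight_indicator; apply: ler_sum => y yX.
  have [/asboolP ndy|_] := boolP `[< _ >]; last first.
    by rewrite mul0r; apply: sumr_ge0 => p _; exact: weight_ge0.
  have [p cp py] := conflict_of_not_diamond ndy.
  rewrite mul1r (bigD1 p) /=; last by rewrite cp yX.
  by rewrite lerDl; apply: sumr_ge0 => p' _; exact: weight_ge0.
apply: ler_sum => p cp; have pk := card_conflict p cp.
rewrite le_eqVlt; apply/predU1P; left.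
transitivity ((k.+2)`!%:R * \sum_(y in faces X k.+2 | apex p \subset y) fw y).
  rewrite mulr_sumr; apply: eq_bigr => y.
  by rewrite inE => /andP[/andP[_ /eqP <-] _]; exact: weightE.
have card_p := card_apex cp.
rewrite sum_flag_weight_sup ?card_p ?ltnS ?pk // !subSS.
by rewrite mulrCA mulrC.
Qed.

Lemma sum_conflicts (c : nat -> R) :
  \sum_(p | conflict T p) c #|p.1| * fw (apex p) =
  \sum_(u : {set V} | (u \notin T) && (#|u| <= k)%N)
     c #|u| * edge_form (lg u) (fun v => (v |: u \in T)%:R).
Proof.
transitivity (\sum_(u : {set V}) \sum_(q : V * V)
    if conflict T (u, q) then c #|u| * fw (apex (u, q)) else 0).
  rewrite pair_bigA big_mkcond; apply: eq_bigr => -[u q] _ //.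
rewrite [RHS]big_mkcond; apply: eq_bigr => u _.
transitivity (\sum_v \sum_v' if conflict T (u, (v, v'))
    then c #|u| * fw (apex (u, (v, v'))) else 0).
  by rewrite pair_bigA; apply: eq_bigr => -[v v'] _.
rewrite /=; case: (u \in T) => /=.
  by rewrite big1 // => v _; rewrite big1.
case: ifPn => uk; last first.
  rewrite big1 // => v _; rewrite big1 // => v' _.
  case: ifP => // /and4P[vu _ _ /andP[/card_fat_le + _]].
  by rewrite cardsU1 vu add1n ltnS (negPf uk).
rewrite mulr_sumr; apply: eq_bigr => v _.
rewrite mulr_sumr; apply: eq_bigr => v' _.
rewrite link_graphE; case: (v \in u); rewrite ?mul0r ?mulr0 //=.
case: (v' \in u); rewrite ?mul0r ?mulr0 //=.
case: (v != v'); rewrite ?mul0r ?mulr0 //=.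
by case: (_ \in T); case: (_ \in T); rewrite ?mulr1 ?mulr0 ?mul0r ?mulr0.
Qed.

Lemma conflict_form_le (l : R) u :
  (u \in X -> mixing_bound (lg u) l) ->
  l <= theta #|u| -> 0 <= theta #|u| -> u \notin T -> (#|u| <= k)%N ->
  edge_form (lg u) (fun v => (v |: u \in T)%:R)
    <= 2 * theta #|u| * up_weight T u.
Proof.
move=> mix l_le theta_ge0 uT uk; have up_ge0 := up_weight_ge0 T u.
have [uX|uX] := boolP (u \in X); last first.
  apply: (@le_trans _ _ 0); last by rewrite !mulr_ge0.
  rewrite /edge_form big1 // => v _; rewrite big1 // => v' _.
  by rewrite link_graph_eq0 // !mul0r.
have degE : degree_sum (lg u) (fun v => (v |: u \in T)%:R) = up_weight T u.
  by apply: eq_bigr => v _; rewrite degree_link_graph // (leq_ltn_trans uk kd).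
have sqrE : degree_sum (lg u) (fun v => (v |: u \in T)%:R ^+ 2) = up_weight T u.
  rewrite -degE; apply: eq_bigr => v _.
  by case: (_ \in T); rewrite ?expr1n ?expr0n.
apply: le_trans (mix uX _) _.
rewrite volume_link_graph ?(leq_ltn_trans uk kd) //.
rewrite degE sqrE -mulrA mulr2n mulrDl !mul1r.
have up_lt : up_weight T u < theta #|u| * fw u.
  by move: uT; rewrite fatT.2 // ltNge => ->.
apply: lerD; first exact: ler_wpM2r.
rewrite expr2 -mulrA mulrC; apply: ler_wpM2r => //.
by rewrite ler_pdivrMr ?flag_weight_gt0 // ltW.
Qed.

Lemma defect_weight_le (l : R) :
  (forall j, (j <= k)%N -> l <= theta j) ->
  (forall j, (j <= k)%N -> 0 <= theta j) ->
  (forall u, u \in X -> (#|u| < d)%N -> mixing_bound (lg u) l) ->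
  defect_weight T R d X k.+2 <=
  2 * (k.+2 * k.+1)%:R *
    \sum_(j < k.+1) 'C(k, j)%:R * (theta j * level_weight T j.+1).
Proof.
move=> l_le theta_ge0 mix; apply: le_trans defect_weight_le_conflicts _.
pose c j : R := (k.+2)`!%:R / (k - j)`!%:R.
rewrite (sum_conflicts c).
have c_ge0 j : 0 <= c j by rewrite divr_ge0.
apply: (@le_trans _ _ (\sum_(u : {set V} | (#|u| <= k)%N)
    c #|u| * (2 * theta #|u| * up_weight T u))).
  rewrite big_mkcondl; apply: ler_sum => u uk.
  have theta_u_ge0 := theta_ge0 _ uk; have up_ge0 := up_weight_ge0 T u.
  case: ifP => [uT|_]; last by rewrite mulr_ge0 // !mulr_ge0.
  apply: ler_wpM2l => //; apply: (conflict_form_le _ (l_le _ uk)) => // uX.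
  by apply: mix; rewrite ?(leq_ltn_trans uk kd).
rewrite le_eqVlt; apply/predU1P; left.
transitivity (\sum_(j < k.+1) \sum_(u : {set V} | #|u| == j)
    c j * (2 * theta j * up_weight T u)).
  pose card_ord (u : {set V}) : 'I_k.+1 := inord #|u|.
  rewrite (partition_big card_ord xpredT) //=; apply: eq_bigr => j _.
  apply: eq_big => u; last by case/andP=> uk /eqP <-; rewrite inordK.
  apply/andP/eqP => [[uk /eqP <-]|uj]; first by rewrite inordK.
  rewrite uj -ltnS ltn_ord /card_ord uj; split=> //.
  by apply/eqP/val_inj; rewrite /= inordK.
rewrite mulr_sumr; apply: eq_bigr => j _.
rewrite -!mulr_sumr sum_up_weight ?fat_subset_complex // /c.
have jk : (j <= k)%N by rewrite -ltnS ltn_ord.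
rewrite !factS -(bin_fact jk) !natrM; field.
by rewrite !fact_neq0.
Qed.

End Counting.
End FatFaces.

Section SmallFatFamilies.
Variables (R : realType) (V : finType) (X : {set {set V}}) (d k : nat).
Hypothesis hX : is_dcomplex d X.
Variables (eta : R) (T : {set {set V}}).
Hypothesis eta_gt0 : 0 < eta.
Hypothesis fatT : fat_family X d k (fun j => eta ^+ (2 ^ (k - j))) T.

Local Notation lw := (level_weight R X d T).

Lemma level_weight_pow i : (i <= k.+1)%N ->
  eta ^+ (2 ^ i - 1) * lw (k.+1 - i)%N <= lw k.+1.
Proof.
elim: i => [|i IH] ik; first by rewrite subn0 expn0 subnn expr0 mul1r.
apply: le_trans (IH (ltnW ik)).
have -> : (2 ^ i.+1 - 1 = (2 ^ i - 1) + 2 ^ i)%N.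
  by have := expn_gt0 2 i; rewrite expnS; lia.
rewrite exprD -mulrA ler_pM2l ?exprn_gt0 // subSS subSn //.
by have := level_weight_step fatT (leq_subr i k); rewrite subKn.
Qed.

Lemma set0_not_fat : lw k.+1 < eta ^+ (2 ^ k.+1 - 1) -> set0 \notin T.
Proof.
move=> small; apply/negP => set0T.
have level0 : 1 <= lw 0%N.
  rewrite level_weightE ?(fat_subset_complex fatT) // mul1r.
  rewrite (bigD1 set0) ?set0T ?cards0 //= (flag_weight_set0 _ hX) lerDl.
  by apply: sumr_ge0 => z _; exact: flag_weight_ge0.
have := level_weight_pow (leqnn _); rewrite subnn => /le_lt_trans/(_ small).
by rewrite gtr_pMr ?exprn_gt0 // ltNge level0.
Qed.

Lemma level_weight_scaled j : (j <= k)%N ->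
  eta ^+ (2 ^ (k - j)) * lw j.+1 <= eta * lw k.+1.
Proof.
move=> jk; have := level_weight_pow (leq_trans (leq_subr j k) (leqnSn k)).
rewrite subSn ?leq_subr // subKn // => pow_le.
have -> : (2 ^ (k - j) = (2 ^ (k - j) - 1).+1)%N.
  by have := expn_gt0 2 (k - j); lia.
by rewrite exprS -mulrA ler_pM2l.
Qed.

Hypothesis kd : (k < d)%N.

Lemma defect_weight_small (l : R) : l <= Num.min (eta ^+ (2 ^ k)) 1 ->
  (forall u, u \in X -> (#|u| < d)%N -> mixing_bound (link_graph R d X u) l) ->
  defect_weight T R d X k.+2 <=
  2 ^+ k.+1 * (k.+2 * k.+1)%:R * eta * lw k.+1.
Proof.
rewrite le_min => /andP[l_pow l_one] mix.
have l_le j : (j <= k)%N -> l <= eta ^+ (2 ^ (k - j)).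
  move=> _; have [eta_ge1|eta_lt1] := leP 1 eta.
    by apply: le_trans l_one _; rewrite exprn_ege1.
  apply: le_trans l_pow _.
  by rewrite ler_wiXn2l ?(ltW eta_gt0) ?(ltW eta_lt1) // leq_exp2l ?leq_subr.
have pow_ge0 j : (j <= k)%N -> 0 <= eta ^+ (2 ^ (k - j)).
  by rewrite exprn_ge0 // ltW.
apply: le_trans (defect_weight_le hX fatT kd l_le pow_ge0 mix) _.
apply: (@le_trans _ _ (2 * (k.+2 * k.+1)%:R *
    \sum_(j < k.+1) 'C(k, j)%:R * (eta * lw k.+1))).
  apply: ler_wpM2l; first by rewrite mulr_ge0.
  apply: ler_sum => j _; apply: ler_wpM2l => //.
  by apply: level_weight_scaled; rewrite -ltnS ltn_ord.
have -> : \sum_(j < k.+1) 'C(k, j)%:R * (eta * lw k.+1)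
    = 2 ^+ k * (eta * lw k.+1).
  rewrite -mulr_suml -natr_sum -natrX -[2%N]/(1 + 1)%N expnDn.
  by congr (_%:R * _); apply: eq_bigr => j _; rewrite !exp1n !muln1.
rewrite exprS; set a := (_ * _)%:R.
by rewrite le_eqVlt; apply/predU1P; left; ring.
Qed.

End SmallFatFamilies.

Section Constants.
Variables (R : realType) (k : nat).

Definition expansion_rate (e : 'I_k.+1 -> R) : R :=
  \big[Num.min/(k.+2%:R * e ord0 / k.+1%:R)]_(i < k.+1)
     (k.+2%:R * e i / (k.+1 - i)%:R).

Definition smallness (eps : R) : R := eps / (k.+1%:R ^+ 2 * 2 ^+ (2 * k + 6)).

Lemma expansion_rate_ge0 e : (forall i, 0 <= e i) -> 0 <= expansion_rate e.
Proof.
move=> e_ge0; rewrite /expansion_rate.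
elim/big_ind: _ => [|a b a_ge0 b_ge0|i _].
- by rewrite divr_ge0 // mulr_ge0.
- by rewrite le_min a_ge0.
- by rewrite divr_ge0 // mulr_ge0.
Qed.

Lemma expansion_rate_le e (i : 'I_k.+1) :
  expansion_rate e * (k.+1 - i)%:R <= k.+2%:R * e i.
Proof.
by rewrite -ler_pdivlMr ?ltr0n ?subn_gt0 // bigmin_le // lexx orbT.
Qed.

Lemma smallness_gt0 eps : 0 < eps -> 0 < smallness eps.
Proof. by move=> eps_gt0; rewrite divr_gt0 // mulr_gt0 // exprn_gt0. Qed.

Lemma smallness_loss_le (eps N : R) : 0 <= eps * N ->
  2 ^+ k.+2 * (2 ^+ k.+1 * (k.+2 * k.+1)%:R * smallness eps * N) <= eps / 2 * N.
Proof.
move=> epsN_ge0; have k_gt0 : 0 < k.+1%:R :> R by rewrite ltr0n.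
have pow_gt0 : 0 < 2 ^+ k :> R by rewrite exprn_gt0.
have -> : 2 ^+ k.+2 * (2 ^+ k.+1 * (k.+2 * k.+1)%:R * smallness eps * N) =
    eps * N * (k.+2%:R / (8 * k.+1%:R)).
  rewrite /smallness natrM !exprS mul2n -addnn !exprD.
  move: (2 ^+ k) (k.+1%:R) (k.+2%:R) pow_gt0 k_gt0 => p q r p_gt0 q_gt0.
  by field; rewrite !gt_eqF.
rewrite [leRHS]mulrAC ler_wpM2l // ler_pdivrMr ?mulr_gt0 // -[k.+2%:R]natr1.
have : 1 <= k.+1%:R :> R by rewrite ler1n.
lra.
Qed.

End Constants.

Section MinimalFamilies.
Variables (R : realType) (V : finType) (X : {set {set V}}) (F : aug_sheaf X).
Variables (d k : nat) (e : 'I_k.+1 -> R) (phi : forall x, F x).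
Hypothesis hX : is_dcomplex d X.
Hypothesis kd : (k < d)%N.
Hypothesis e_ge0 : forall i, 0 <= e i.
Hypothesis local_exp :
  forall i : 'I_k.+1, local_cobd_expander F d i.+1 k.+1 (e i).
Hypothesis ntriv : forall x, x \in faces X k.+2 -> nontrivial (F x).
Hypothesis min_phi : minimal_family R d k.+1 phi.

Lemma mask_expansion z (D : pred {set V}) :
  z \in X -> z != set0 -> (#|z| <= k.+1)%N -> (forall y, D y -> z \subset y) ->
  expansion_rate e * support_weight R d k.+1 (mask D phi) <=
  support_weight R d k.+2 (face_cobd (mask D phi)).
Proof.
move=> zX z_neq0 zk Dz; have z_gt0 : (0 < #|z|)%N by rewrite card_gt0.
have ik : (#|z|.-1 < k.+1)%N by rewrite prednK.
pose i := Ordinal ik; have iz : i.+1 = #|z| by rewrite /= prednK.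
have expz : cobd_expander (link_sheaf F z) (d - #|z|) (k.+1 - #|z|) (e i).
  have := local_exp (i := i) (z := z); rewrite iz; apply.
  by rewrite inE zX eqxx.
have := local_expansion hX zX zk kd ntriv expz min_phi z_neq0 (e_ge0 i) Dz.
rewrite -iz subSS => expand.
have ki_gt0 : 0 < (k.+1 - i)%:R :> R by rewrite ltr0n subn_gt0.
rewrite -(ler_pM2l ki_gt0); apply: le_trans expand.
rewrite mulrA; apply: ler_wpM2r; first exact: support_weight_ge0.
by rewrite mulrC [e i * _]mulrC; exact: expansion_rate_le.
Qed.

Variables (l : R).
Hypothesis l_le : l <= Num.min (smallness k (expansion_rate e) ^+ (2 ^ k)) 1.
Hypothesis mix : forall u, u \in X -> (#|u| < d)%N ->
  mixing_bound (link_graph R d X u) l.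

Lemma small_minimal_family_expands :
  support_weight R d k.+1 phi
    < smallness k (expansion_rate e) ^+ (2 ^ k.+1 - 1) ->
  expansion_rate e / 2 * support_weight R d k.+1 phi
    <= support_weight R d k.+2 (face_cobd phi).
Proof.
set eps := expansion_rate e; set N := support_weight _ _ k.+1 _ => small.
have := expansion_rate_ge0 e_ge0; rewrite -/eps le_eqVlt.
case/orP=> [/eqP <-|eps_gt0]; first by rewrite !mul0r support_weight_ge0.
have eta_gt0 := smallness_gt0 k eps_gt0.
have suppX : [set x in faces X k.+1 | phi x != 0] \subset faces X k.+1.
  by apply/subsetP => x /setIdP[].
pose threshold j := smallness k eps ^+ (2 ^ (k - j)).
have [T fatT TE] := fat_family_exists d threshold suppX.
have suppT x : x \in faces X k.+1 -> (x \in T) = (phi x != 0).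
  by move=> xX; rewrite TE // inE xX.
have levelN : level_weight R X d T k.+1 = N.
  by apply: eq_total_weight => x /suppT.
have T0 : set0 \notin T.
  by apply: (set0_not_fat hX eta_gt0 fatT); rewrite levelN.
have := defect_weight_small hX eta_gt0 fatT kd l_le mix.
rewrite levelN => /(ler_wpM2l (exprn_ge0 k.+2 (ler0n R 2))) defect_le.
have piece_exp z : terminal T z ->
    eps * support_weight R d k.+1 (piece T phi z) <=
    support_weight R d k.+2 (face_cobd (piece T phi z)).
  case/andP=> zT _; apply: mask_expansion.
  - exact: subsetP (fat_subset_complex fatT) _ zT.
  - by apply: contraNneq T0 => <-.
  - exact: (card_fat_le fatT).
  - by move=> y; exact: connect_descent_subset.
have expand := pieces_expand (face_subset hX) suppT (ltW eps_gt0) piece_exp.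
have epsN_ge0 : 0 <= eps * N.
  by rewrite mulr_ge0 ?(ltW eps_gt0) ?support_weight_ge0.
have loss_le := smallness_loss_le k epsN_ge0.
have := le_trans expand (lerD (lexx _) (le_trans defect_le loss_le)).
rewrite -/N [eps / 2 * N]mulrAC.
by move: (eps * N) (support_weight _ _ k.+2 (face_cobd phi)) => a b; lra.
Qed.

End MinimalFamilies.

Theorem theorem8p2 (R : realType) (k : nat) (e : 'I_k.+1 -> R) (eps lambda : R)
  (V : finType) (X : {set {set V}}) (F : aug_sheaf X) (d : nat)
  (he : forall i, 0 <= e i)
  (heps : eps = \big[Num.min/(k.+2%:R * e ord0 / k.+1%:R)]_(i < k.+1)
                   (k.+2%:R * e i / (k.+1 - i)%:R))
  (hlambda : lambda = d%:R^-1 *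
      Num.min ((eps / (k.+1%:R ^+ 2 * 2 ^+ (2 * k + 6))) ^+ (2 ^ k)) 1)
  (hd : (k.+1 <= d)%N)
  (hX : is_dcomplex d X)
  (hconn : strongly_connected d X)
  (hF : is_sheaf F)
  (hcb : forall i : 'I_k.+1, local_cobd_expander F d i.+1 k.+1 (e i))
  (hspec : local_spectral_expander d X d.-1 (-1) lambda)
  (hne : forall x, x \in faces X k.+2 -> nontrivial (F x)) :
  expands_small_locally_minimal F d k.+1 (eps / 2)
    ((eps / (k.+1%:R ^+ 2 * 2 ^+ (2 * k + 6))) ^+ (2 ^ k.+1 - 1)).
Proof.
move=> f cf min_f; have fphi := oriented_by_orient cf.
rewrite (norm_oriented_by R d fphi).
rewrite (norm_oriented_by R d (oriented_by_cobd (face_subset hX) fphi)).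
rewrite -/(smallness k eps) -/(expansion_rate e) in heps hlambda *.
have d_gt0 : 0 < d%:R :> R by rewrite ltr0n (leq_ltn_trans (leq0n k)).
have eps_ge0 : 0 <= eps by rewrite heps expansion_rate_ge0.
have dlambda : d%:R * lambda = Num.min (smallness k eps ^+ (2 ^ k)) 1.
  by rewrite hlambda mulVKf ?gt_eqF.
have lambda_ge0 : 0 <= lambda.
  rewrite -(pmulr_rge0 _ d_gt0) dlambda le_min ler01 andbT exprn_ge0 //.
  by rewrite divr_ge0 // mulr_ge0 ?exprn_ge0.
have lambda_le : lambda * d%:R <= 1 by rewrite mulrC dlambda ge_min lexx orbT.
have min_phi := minimal_family_of_cochain hX cf fphi min_f.
rewrite heps in dlambda *.
apply: (small_minimal_family_expands hX hd he hcb hne min_phi) => [|u uX ud].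
  by rewrite -dlambda.
exact: (mixing_bound_of_local_expander _ lambda_ge0 lambda_le hconn hspec).
Qed.
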